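(* Let $p$ be a prime, let $K\supset\mu_p$ be a field, and set $A_K^\bullet:=H^\bullet(G_K(p),\mathbb F_p)$. For a subspace $W\subset A_K^1$ let $\langle W\rangle$ denote the graded subalgebra of $A_K^\bullet$ generated by $W$. Assume that for every finite-dimensional subspace $W\subset A_K^1$ there exist: (i) a finite set $S=S(W)$ of places or local data, with associated fields $K_v$ ($v\in S$); (ii) a graded algebra homomorphism $\lambda_S\colon A_K^\bullet\to A_S^\bullet:=\prod_{v\in S}H^\bullet(G_{K_v}(p),\mathbb F_p)$; (iii) a finite-type universally Koszul quadratic algebra $B_W$; (iv) an isomorphism of graded algebras $\phi_W\colon\langle W\rangle\xrightarrow{\sim}B_W$; such that: (a) $\phi_W$ is induced by $\lambda_S$; (b) the family is compatible under inclusion, that is, $W\subset W'$ implies $\langle W\rangle\subset\langle W'\rangle$ and $B_W\subset B_{W'}$. Then $A_K^\bullet$ is a filtered union of finite-type universally Koszul quadratic subalgebras, and hence asymptotically universally Koszul.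
   Context: $\mu_p$ is the group of $p$-th roots of unity. For a field $K$, $G_K(p)$ is the maximal pro-$p$ quotient of the absolute Galois group of $K$, and $H^\bullet(-,\mathbb F_p)$ is continuous cohomology, a graded-commutative $\mathbb F_p$-algebra under cup product. ''$\phi_W$ is induced by $\lambda_S$'' means that $B_W$ is identified with the subalgebra $\lambda_S(\langle W\rangle)$ of $A_S^\bullet$ and $\phi_W$ with the restriction of $\lambda_S$ to $\langle W\rangle$; ''$B_W\subset B_{W'}$'' is an inclusion (embedding) of graded algebras. Below $k=\mathbb F_p$. A graded $k$-algebra $A=\bigoplus_{n\ge 0}A_n$ is connected if $A_0=k$. A connected graded $k$-algebra generated in degree $1$ is quadratic if $A\cong T(V)/\langle R\rangle$ as graded algebras, where $V=A_1$ (possibly infinite-dimensional) and $R\subseteq V\otimes_k V$ is a subspace. A quadratic algebra $A$ is of finite type if $\dim_k A_1<\infty$. Universal Koszulity: let $A$ be a quadratic algebra with $\dim_k A_1<\infty$. Let $\mathcal L(A)$ be the set of graded left ideals $I\subseteq A$ with $I=A I_1$ (generated in degree $1$). $A$ is universally Koszul if for every $I\in\mathcal L(A)$ and every $x\in A_1\setminus I_1$, the colon ideal $I:x=\{a\in A\mid ax\in I\}$ belongs to $\mathcal L(A)$. Asymptotic universal Koszulity: a connected graded $k$-algebra $A$ generated in degree $1$ is asymptotically universally Koszul if there exists a filtered system (under inclusion) of quadratic graded subalgebras $(A_i)_{i\in I}$ of $A$ such that (i) each $A_i$ is generated in degree $1$ with $\dim_k(A_i)_1<\infty$; (ii) each $A_i$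 is universally Koszul; (iii) the natural map $\varinjlim_{i\in I}A_i\to A$ is an isomorphism of graded algebras; (iv) every finite-dimensional subspace of $A_1$ is contained in some $(A_i)_1$. That $A_K^\bullet$ is generated in degree $1$ (as a consequence of the norm residue isomorphism theorem) is taken as known. *)

(* Defs.v *)
From HB Require Import structures.
From mathcomp Require Import all_boot all_algebra separable ring.
From mathcomp Require Import boolp classical_sets functions cardinality.
From mathcomp Require Import topology.

Set Implicit Arguments.
Unset Strict Implicit.
Unset Printing Implicit Defensive.

Import GRing.Theory.
Local Open Scope classical_set_scope.
Local Open Scope ring_scope.

(* An internally graded unital associative algebra over k.  The k-algebra
   structure is given by its structure map, a ring morphism from k to the centre
   of A: MathComp's algType excludes the zero algebra, which is the product of
   an empty family.  The last two axioms say that A is the direct sum of its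
   homogeneous components. *)
HB.mixin Record isGradedAlg (k : fieldType) A of GRing.PzRing A := {
  galg : k -> A ;
  galg_zmod_morphism : zmod_morphism galg ;
  galg_monoid_morphism : monoid_morphism galg ;
  galgC : forall c x, galg c * x = x * galg c ;
  gr : nat -> set A ;
  gr0 : forall n, gr n 0 ;
  grP : forall n c x y, gr n x -> gr n y -> gr n (galg c * x + y) ;
  gr1 : gr 0%N 1 ;
  grM : forall m n x y, gr m x -> gr n y -> gr (m + n)%N (x * y) ;
  gr_decomp : forall x, exists N (y : nat -> A),
    (forall i, gr i (y i)) /\ x = \sum_(i < N) y i ;
  gr_indep : forall N (y : nat -> A), (forall i, gr i (y i)) ->
    \sum_(i < N) y i = 0 -> forall i, (i < N)%N -> y i = 0
}.

#[short(type="gralgType")]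
HB.structure Definition GradedAlg (k : fieldType) :=
  {A of isGradedAlg k A & GRing.PzRing A}.

HB.instance Definition _ (k : fieldType) (A : gralgType k) :=
  GRing.isZmodMorphism.Build k A (@galg k A) galg_zmod_morphism.
HB.instance Definition _ (k : fieldType) (A : gralgType k) :=
  GRing.isMonoidMorphism.Build k A (@galg k A) galg_monoid_morphism.

Arguments gr {k A} n _ : rename.
Arguments galg {k A} c : rename.

Section GradedTheory.
Variables (k : fieldType) (A : gralgType k).
Implicit Types (x y : A) (n : nat) (c : k).

Lemma grD n x y : gr n x -> gr n y -> gr n (x + y).
Proof. by move=> hx hy; rewrite -[x]mul1r -(rmorph1 (@galg k A)); exact: grP. Qed.

Lemma grZ n c x : gr n x -> gr n (galg c * x).
Proof. by move=> hx; rewrite -[_ * _]addr0; apply: grP => //; exact: gr0. Qed.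

Lemma grN n x : gr n x -> gr n (- x).
Proof.
by move=> hx; rewrite -mulN1r -(rmorph1 (@galg k A)) -rmorphN; exact: grZ.
Qed.

Lemma gr_uniq N M (y z : nat -> A) :
    (forall i, gr i (y i)) -> (forall i, gr i (z i)) ->
  \sum_(i < N) y i = \sum_(i < M) z i ->
  forall i, (if (i < N)%N then y i else 0) = (if (i < M)%N then z i else 0).
Proof.
move=> hy hz e i.
pose w j := (if (j < N)%N then y j else 0) - (if (j < M)%N then z j else 0).
have hw j : gr j (w j).
  by apply: grD; [|apply: grN]; case: ifP => _ //; exact: gr0.
pose B := maxn (maxn N M) i.+1.
have widen P (v : nat -> A) : (P <= B)%N ->
    \sum_(j < P) v j = \sum_(j < B) (if (j < P)%N then v j else 0).
  by move=> h; rewrite (big_ord_widen _ v h) big_mkcond.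
have NB : (N <= B)%N by rewrite !leq_max leqnn.
have MB : (M <= B)%N by rewrite !leq_max leqnn orbT.
have iB : (i < B)%N by rewrite leq_max ltnSn orbT.
have := @gr_indep _ A B w hw.
rewrite big_split /= sumrN -!widen // e subrr => /(_ erefl i iB)/eqP.
by rewrite subr_eq0 => /eqP.
Qed.

Definition subspace (W : set A) : Prop :=
  W 0 /\ forall c x y, W x -> W y -> W (galg c * x + y).

Definition fin_dim (W : set A) : Prop :=
  exists s : seq A,
    W = [set x | exists c : nat -> k, x = \sum_(i < size s) galg (c i) * s`_i].

Definition homogeneous (S : set A) : Prop :=
  forall x, S x -> exists N (y : nat -> A),
    (forall i, gr i (y i) /\ S (y i)) /\ x = \sum_(i < N) y i.

Definition subalgebra (S : set A) : Prop :=
  [/\ subspace S, S 1 & forall x y, S x -> S y -> S (x * y)].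

Definition left_ideal (I : set A) : Prop :=
  subspace I /\ forall a x, I x -> I (a * x).

Definition two_sided_ideal (I : set A) : Prop :=
  left_ideal I /\ forall a x, I x -> I (x * a).

Definition graded_subalgebra (S : set A) := subalgebra S /\ homogeneous S.
Definition graded_left_ideal (I : set A) := left_ideal I /\ homogeneous I.
Definition graded_ideal (I : set A) := two_sided_ideal I /\ homogeneous I.

Record gsub := GSub { gsub_set :> set A ; gsubP : graded_subalgebra gsub_set }.
Record gideal :=
  GIdeal { gideal_set :> set A ; gidealP : graded_ideal gideal_set }.

Lemma subspaceD (S : set A) x y : subspace S -> S x -> S y -> S (x + y).
Proof.
by move=> [_ h] hx hy; rewrite -[x]mul1r -(rmorph1 (@galg k A)); exact: h.
Qed.

Lemma subspaceN (S : set A) x : subspace S -> S x -> S (- x).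
Proof.
move=> [h0 h] hx; rewrite -[- x]addr0 -mulN1r -(rmorph1 (@galg k A)) -rmorphN.
exact: h.
Qed.

Lemma homogeneous_comp (S : set A) N (y : nat -> A) : homogeneous S -> S 0 ->
  (forall i, gr i (y i)) -> S (\sum_(i < N) y i) ->
  forall i, (i < N)%N -> S (y i).
Proof.
move=> hS S0 hy /hS [M [z [hz e]]] i iN.
have := gr_uniq hy (fun j => (hz j).1) e i.
by rewrite iN => ->; case: ifP => // _; exact: (hz i).2.
Qed.

Lemma smallest_homogeneous (P : set A -> Prop) (G : set A) :
    (forall S, P S -> S 0 /\ homogeneous S) ->
  homogeneous (smallest P G).
Proof.
move=> hP x hx; have [N [y [hy e]]] := gr_decomp x.
exists N, (fun i => if (i < N)%N then y i else 0); split; last first.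
  by rewrite e; apply: eq_bigr => i _; rewrite ltn_ord.
move=> i; split; first by case: ifP => _ //; exact: gr0.
move=> S [PS GS]; have [S0 hS] := hP _ PS; case: ifP => iN //.
apply: (homogeneous_comp hS S0 hy _ iN); rewrite -e; exact: hx.
Qed.

Lemma gen_gsub_subproof (W : set A) :
  graded_subalgebra (smallest graded_subalgebra W).
Proof.
split; last by apply: smallest_homogeneous => S [[[]]].
split.
- split=> [S [[[[S0 _] _ _] _] _]|c u v hu hv S hS] //.
  by case: (hS) => -[[[_ hl] _ _] _] _; apply: hl; [exact: hu|exact: hv].
- by move=> S [[[]]].
- move=> x y hx hy S hS; case: (hS) => -[[_ _ hm] _] _.
  by apply: hm; [exact: hx|exact: hy].
Qed.

Definition gen_gsub (W : set A) : gsub := GSub (gen_gsub_subproof W).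

Lemma gen_gideal_subproof (R : set A) :
  graded_ideal (smallest graded_ideal R).
Proof.
split; last by apply: smallest_homogeneous => S [[[[]]]].
split; [split; first split|].
- by move=> S [[[[[]]]]].
- move=> c u v hu hv S hS; case: (hS) => -[[[[_ hl] _] _] _] _.
  by apply: hl; [exact: hu|exact: hv].
- by move=> a x hx S hS; case: (hS) => -[[[_ hl] _] _] _; exact: hl (hx _ hS).
- by move=> a x hx S hS; case: (hS) => -[[_ hl] _] _; exact: hl (hx _ hS).
Qed.

(* For a set R of homogeneous elements, the two-sided ideal generated by R is
   homogeneous, so this is that ideal. *)
Definition gen_gideal (R : set A) : gideal := GIdeal (gen_gideal_subproof R).

End GradedTheory.

Section GradedHom.
Variables (k : fieldType) (A B : gralgType k).

Definition graded_hom (f : A -> B) : Prop :=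
  [/\ zmod_morphism f, monoid_morphism f,
      (forall c, f (galg c) = galg c) & forall n x, gr n x -> gr n (f x)].

Definition graded_iso (f : A -> B) : Prop := graded_hom f /\ bijective f.

End GradedHom.

Section GradedPiece.
Variables (k : fieldType) (A : gralgType k) (n : nat).

Definition gr_pred : {pred A} := fun x => `[< gr n x >].

Fact gr_pred_closed : zmod_closed gr_pred.
Proof.
split; first by apply/asboolP; exact: gr0.
by move=> x y /asboolP hx /asboolP hy; apply/asboolP/grD/grN.
Qed.

HB.instance Definition _ := GRing.isZmodClosed.Build A gr_pred gr_pred_closed.

(* The homogeneous component of degree n, as a vector space. *)
Definition gr_piece : Type := {x : A | gr_pred x}.
HB.instance Definition _ := SubChoice.on gr_piece.
HB.instance Definition _ := [SubChoice_isSubZmodule of gr_piece by <:].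

Fact gr_piece_scale_subproof (c : k) (x : gr_piece) : gr_pred (galg c * val x).
Proof. by apply/asboolP/grZ/asboolP; exact: (valP x). Qed.

Definition gr_piece_scale (c : k) (x : gr_piece) : gr_piece :=
  Sub (galg c * val x) (gr_piece_scale_subproof c x).

Fact gr_piece_scalerA a b v :
  gr_piece_scale a (gr_piece_scale b v) = gr_piece_scale (a * b) v.
Proof. by apply: val_inj; rewrite !SubK rmorphM mulrA. Qed.
Fact gr_piece_scale1r : left_id 1 gr_piece_scale.
Proof. by move=> v; apply: val_inj; rewrite SubK rmorph1 mul1r. Qed.
Fact gr_piece_scalerDr : right_distributive gr_piece_scale +%R.
Proof. by move=> c u v; apply: val_inj; rewrite !(SubK, raddfD) /= mulrDr. Qed.
Fact gr_piece_scalerDl v : {morph gr_piece_scale^~ v : a b / a + b}.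
Proof. by move=> a b; apply: val_inj; rewrite !(SubK, raddfD) /= mulrDl. Qed.

HB.instance Definition _ := GRing.Zmodule_isLmodule.Build k gr_piece
  gr_piece_scalerA gr_piece_scale1r gr_piece_scalerDr gr_piece_scalerDl.

End GradedPiece.

Section GradedSub.
Variables (k : fieldType) (A : gralgType k) (S : gsub A).

Definition gsub_pred : {pred A} := fun x => `[< gsub_set S x >].

Fact gsub_pred_closed : subring_closed gsub_pred.
Proof.
have [[hs h1 hM] _] := gsubP S.
split=> [|x y /asboolP hx /asboolP hy|x y /asboolP hx /asboolP hy];
  apply/asboolP => //; last exact: hM.
by apply: subspaceD => //; exact: subspaceN.
Qed.

HB.instance Definition _ :=
  GRing.isSubringClosed.Build A gsub_pred gsub_pred_closed.

Definition gsub_type : Type := {x : A | gsub_pred x}.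
HB.instance Definition _ := SubChoice.on gsub_type.
HB.instance Definition _ :=
  GRing.SubChoice_isSubPzRing.Build A gsub_pred gsub_type gsub_pred_closed.

Lemma gsub_galg_subproof c : gsub_pred (galg c).
Proof.
have [[[h0 hl] h1 _] _] := gsubP S; apply/asboolP.
by rewrite -[galg c]mulr1 -[_ * _]addr0; exact: hl.
Qed.

Definition gsub_galg (c : k) : gsub_type := Sub (galg c) (gsub_galg_subproof c).
Definition gsub_gr (n : nat) : set gsub_type := [set x | gr n (val x)].

Fact gsub_galg_zmod : zmod_morphism gsub_galg.
Proof. by move=> a b; apply: val_inj; rewrite raddfB /= rmorphB. Qed.
Fact gsub_galg_monoid : monoid_morphism gsub_galg.
Proof.
by split=> [|a b]; apply: val_inj; rewrite ?rmorphM /= ?rmorph1 ?rmorphM.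
Qed.
Fact gsub_galgC c x : gsub_galg c * x = x * gsub_galg c.
Proof. by apply: val_inj; rewrite !rmorphM /= galgC. Qed.
Fact gsub_gr0 n : gsub_gr n 0. Proof. exact: gr0. Qed.
Fact gsub_grP n c x y :
  gsub_gr n x -> gsub_gr n y -> gsub_gr n (gsub_galg c * x + y).
Proof. exact: grP. Qed.
Fact gsub_gr1 : gsub_gr 0 1. Proof. exact: gr1. Qed.
Fact gsub_grM m n x y :
  gsub_gr m x -> gsub_gr n y -> gsub_gr (m + n) (x * y).
Proof. exact: grM. Qed.
Fact gsub_decomp x : exists N (y : nat -> gsub_type),
  (forall i, gsub_gr i (y i)) /\ x = \sum_(i < N) y i.
Proof.
have [_ hS] := gsubP S.
have [N [y [hy e]]] := hS _ (elimT (asboolP _) (valP x)).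
exists N, (fun i => Sub (y i) (introT (asboolP _) (hy i).2)); split.
  by move=> i; exact: (hy i).1.
by apply: val_inj; rewrite raddf_sum /= e; apply: eq_bigr.
Qed.
Fact gsub_indep N (y : nat -> gsub_type) : (forall i, gsub_gr i (y i)) ->
  \sum_(i < N) y i = 0 -> forall i, (i < N)%N -> y i = 0.
Proof.
move=> hy e i iN; apply: val_inj => /=.
apply: (@gr_indep _ A N (fun i => val (y i))) iN => //.
by rewrite -raddf_sum e.
Qed.

HB.instance Definition _ := isGradedAlg.Build k gsub_type
  gsub_galg_zmod gsub_galg_monoid gsub_galgC gsub_gr0 gsub_grP gsub_gr1 gsub_grM
  gsub_decomp gsub_indep.

End GradedSub.

Section GradedQuotient.
Variables (k : fieldType) (A : gralgType k) (I : gideal A).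
Local Open Scope quotient_scope.

Definition gideal_pred : {pred A} := fun x => `[< gideal_set I x >].

Fact gideal_pred_closed : zmod_closed gideal_pred.
Proof.
have [[[hs _] _] _] := gidealP I; split; first by apply/asboolP; exact: hs.1.
move=> x y /asboolP hx /asboolP hy; apply/asboolP.
by apply: subspaceD => //; exact: subspaceN.
Qed.

HB.instance Definition _ :=
  GRing.isZmodClosed.Build A gideal_pred gideal_pred_closed.

Definition gquot : Type := Quotient.quot (gideal_pred : zmodClosed A).
HB.instance Definition _ := Quotient.on gquot.
HB.instance Definition _ := GRing.Zmodule.on gquot.

Definition gquot_pi (x : A) : gquot :=
  \pi_(Quotient.quot (gideal_pred : zmodClosed A)) x.
Local Notation pi := gquot_pi.
Implicit Types u v w : gquot.

Fact gquot_eqP x y : (pi x = pi y) <-> gideal_set I (x - y).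
Proof.
split=> [/eqmodP|h].
  by rewrite /= Quotient.equivE => /asboolP.
by apply/eqmodP; rewrite /= Quotient.equivE; exact/asboolP.
Qed.

Fact gquot_surj u : exists x, u = pi x.
Proof. by exists (repr u); rewrite /gquot_pi reprK. Qed.

Fact gquot_piB : zmod_morphism pi.
Proof. by move=> x y; rewrite /gquot_pi !piE. Qed.

HB.instance Definition _ := GRing.isZmodMorphism.Build A gquot pi gquot_piB.

Definition gquot_mul u v : gquot := pi (repr u * repr v).

Fact gquot_mulE x y : gquot_mul (pi x) (pi y) = pi (x * y).
Proof.
have [[[hs hl] hr] _] := gidealP I.
have rP z : gideal_set I (repr (pi z) - z).
  by apply/gquot_eqP; rewrite /gquot_pi reprK.
apply/gquot_eqP; set a := repr _; set b := repr _.
have -> : a * b - x * y = (a - x) * b + x * (b - y).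
  by rewrite mulrBl mulrBr addrA subrK.
by apply: subspaceD => //; [apply: hr|apply: hl]; exact: rP.
Qed.

Fact gquot_mulA : associative gquot_mul.
Proof.
move=> u v w; have [x ->] := gquot_surj u; have [y ->] := gquot_surj v.
by have [z ->] := gquot_surj w; rewrite !gquot_mulE mulrA.
Qed.
Fact gquot_mul1 : left_id (pi 1) gquot_mul.
Proof.
by move=> u; have [x ->] := gquot_surj u; rewrite gquot_mulE mul1r.
Qed.
Fact gquot_mulr1 : right_id (pi 1) gquot_mul.
Proof.
by move=> u; have [x ->] := gquot_surj u; rewrite gquot_mulE mulr1.
Qed.
Fact gquot_mulDl : left_distributive gquot_mul +%R.
Proof.
move=> u v w; have [x ->] := gquot_surj u; have [y ->] := gquot_surj v.
by have [z ->] := gquot_surj w; rewrite -raddfD !gquot_mulE mulrDl raddfD.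
Qed.
Fact gquot_mulDr : right_distributive gquot_mul +%R.
Proof.
move=> u v w; have [x ->] := gquot_surj u; have [y ->] := gquot_surj v.
by have [z ->] := gquot_surj w; rewrite -raddfD !gquot_mulE mulrDr raddfD.
Qed.

HB.instance Definition _ := GRing.Zmodule_isPzRing.Build gquot
  gquot_mulA gquot_mul1 gquot_mulr1 gquot_mulDl gquot_mulDr.

Fact gquot_piM : monoid_morphism pi.
Proof. by split=> // x y; exact: esym (gquot_mulE x y). Qed.

HB.instance Definition _ := GRing.isMonoidMorphism.Build A gquot pi gquot_piM.

Definition gquot_galg (c : k) : gquot := pi (galg c).
Definition gquot_gr (n : nat) : set gquot := pi @` gr n.

Fact gquot_galg_zmod : zmod_morphism gquot_galg.
Proof. by move=> a b; rewrite /gquot_galg rmorphB raddfB. Qed.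
Fact gquot_galg_monoid : monoid_morphism gquot_galg.
Proof. by split=> [|a b]; rewrite /gquot_galg ?rmorph1 // !rmorphM. Qed.
Fact gquot_galgC c u : gquot_galg c * u = u * gquot_galg c.
Proof. by have [x ->] := gquot_surj u; rewrite -!rmorphM /= galgC. Qed.
Fact gquot_gr0 n : gquot_gr n 0.
Proof. by exists 0; [exact: gr0|exact: raddf0]. Qed.
Fact gquot_grP n c u v :
  gquot_gr n u -> gquot_gr n v -> gquot_gr n (gquot_galg c * u + v).
Proof.
move=> [x hx <-] [y hy <-]; exists (galg c * x + y); first exact: grP.
by rewrite rmorphD rmorphM.
Qed.
Fact gquot_gr1 : gquot_gr 0 1.
Proof. by exists 1; [exact: gr1|exact: rmorph1]. Qed.
Fact gquot_grM m n u v :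
  gquot_gr m u -> gquot_gr n v -> gquot_gr (m + n) (u * v).
Proof.
by move=> [x hx <-] [y hy <-]; exists (x * y); [exact: grM|rewrite rmorphM].
Qed.
Fact gquot_decomp u : exists N (y : nat -> gquot),
  (forall i, gquot_gr i (y i)) /\ u = \sum_(i < N) y i.
Proof.
have [x ->] := gquot_surj u; have [N [y [hy ->]]] := gr_decomp x.
by exists N, (pi \o y); split=> [i|]; [exists (y i)|rewrite raddf_sum].
Qed.
Fact gquot_indep N (y : nat -> gquot) : (forall i, gquot_gr i (y i)) ->
  \sum_(i < N) y i = 0 -> forall i, (i < N)%N -> y i = 0.
Proof.
move=> hy e i iN.
have /choice [z hz] : forall j, exists x, gr j x /\ pi x = y j.
  by move=> j; have [x] := hy j; exists x.
have [[[[h0 _] _] _] hI] := gidealP I.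
have : pi (\sum_(j < N) z j) = pi 0.
  by rewrite raddf_sum raddf0 -[RHS]e; apply: eq_bigr => j _; exact: (hz j).2.
move/gquot_eqP; rewrite subr0 => hs.
rewrite -(hz i).2 -[RHS](raddf0 pi); apply/gquot_eqP; rewrite subr0.
by apply: (homogeneous_comp hI h0 _ hs iN) => j; exact: (hz j).1.
Qed.

HB.instance Definition _ := isGradedAlg.Build k gquot
  gquot_galg_zmod gquot_galg_monoid gquot_galgC gquot_gr0 gquot_grP gquot_gr1
  gquot_grM gquot_decomp gquot_indep.

End GradedQuotient.

Section GradedProduct.
Variables (k : fieldType) (S : finType) (A : S -> gralgType k).

Definition gprod : Type := forall v, A v.
Implicit Types x y : gprod.

HB.instance Definition _ := gen_eqMixin gprod.
HB.instance Definition _ := gen_choiceMixin gprod.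

Definition gprod0 : gprod := fun=> 0.
Definition gprod1 : gprod := fun=> 1.
Definition gprod_opp x : gprod := fun v => - x v.
Definition gprod_add x y : gprod := fun v => x v + y v.
Definition gprod_mul x y : gprod := fun v => x v * y v.

Fact gprod_addA : associative gprod_add.
Proof. by move=> x y z; apply: functional_extensionality_dep => v; exact: addrA. Qed.
Fact gprod_addC : commutative gprod_add.
Proof. by move=> x y; apply: functional_extensionality_dep => v; exact: addrC. Qed.
Fact gprod_add0 : left_id gprod0 gprod_add.
Proof. by move=> x; apply: functional_extensionality_dep => v; exact: add0r. Qed.
Fact gprod_addN : left_inverse gprod0 gprod_opp gprod_add.
Proof. by move=> x; apply: functional_extensionality_dep => v; exact: addNr. Qed.
HB.instance Definition _ :=
  GRing.isZmodule.Build gprod gprod_addA gprod_addC gprod_add0 gprod_addN.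

Fact gprod_mulA : associative gprod_mul.
Proof. by move=> x y z; apply: functional_extensionality_dep => v; exact: mulrA. Qed.
Fact gprod_mul1 : left_id gprod1 gprod_mul.
Proof. by move=> x; apply: functional_extensionality_dep => v; exact: mul1r. Qed.
Fact gprod_mulr1 : right_id gprod1 gprod_mul.
Proof. by move=> x; apply: functional_extensionality_dep => v; exact: mulr1. Qed.
Fact gprod_mulDl : left_distributive gprod_mul +%R.
Proof. by move=> x y z; apply: functional_extensionality_dep => v; exact: mulrDl. Qed.
Fact gprod_mulDr : right_distributive gprod_mul +%R.
Proof. by move=> x y z; apply: functional_extensionality_dep => v; exact: mulrDr. Qed.
HB.instance Definition _ := GRing.Zmodule_isPzRing.Build gprod
  gprod_mulA gprod_mul1 gprod_mulr1 gprod_mulDl gprod_mulDr.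

Definition gprod_galg (c : k) : gprod := fun v => galg c.
Definition gprod_gr (n : nat) : set gprod := [set x | forall v, gr n (x v)].

Fact gprod_sumE N (y : nat -> gprod) v :
  (\sum_(i < N) y i) v = \sum_(i < N) y i v.
Proof.
by elim: N => [|N IH]; rewrite ?big_ord0 // !big_ord_recr /= -IH.
Qed.

Fact gprod_galg_zmod : zmod_morphism gprod_galg.
Proof.
by move=> a b; apply: functional_extensionality_dep => v; exact: rmorphB.
Qed.
Fact gprod_galg_monoid : monoid_morphism gprod_galg.
Proof.
by split=> [|a b]; apply: functional_extensionality_dep => v;
  [exact: rmorph1|exact: rmorphM].
Qed.
Fact gprod_galgC c x : gprod_galg c * x = x * gprod_galg c.
Proof. by apply: functional_extensionality_dep => v; exact: galgC. Qed.
Fact gprod_gr0 n : gprod_gr n 0. Proof. by move=> v; exact: gr0. Qed.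
Fact gprod_grP n c x y :
  gprod_gr n x -> gprod_gr n y -> gprod_gr n (gprod_galg c * x + y).
Proof. by move=> hx hy v; exact: grP. Qed.
Fact gprod_gr1 : gprod_gr 0 1. Proof. by move=> v; exact: gr1. Qed.
Fact gprod_grM m n x y :
  gprod_gr m x -> gprod_gr n y -> gprod_gr (m + n) (x * y).
Proof. by move=> hx hy v; exact: grM. Qed.
Fact gprod_decomp x : exists N (y : nat -> gprod),
  (forall i, gprod_gr i (y i)) /\ x = \sum_(i < N) y i.
Proof.
have hN v : exists N, exists y : nat -> A v,
    (forall i, gr i (y i)) /\ x v = \sum_(i < N) y i by exact: gr_decomp.
pose N v := projT1 (cid (hN v)).
pose y v := projT1 (cid (projT2 (cid (hN v)))).
have hy v : (forall i, gr i (y v i)) /\ x v = \sum_(i < N v) y v i.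
  exact: projT2 (cid (projT2 (cid (hN v)))).
pose z i : gprod := fun v => if (i < N v)%N then y v i else 0.
exists (\max_v N v), z; split.
  by move=> i v; rewrite /z; case: ifP => _; [exact: (hy v).1|exact: gr0].
apply: functional_extensionality_dep => v; rewrite (gprod_sumE _ z) (hy v).2.
by rewrite (big_ord_widen _ (y v) (leq_bigmax v)) big_mkcond.
Qed.
Fact gprod_indep N (y : nat -> gprod) : (forall i, gprod_gr i (y i)) ->
  \sum_(i < N) y i = 0 -> forall i, (i < N)%N -> y i = 0.
Proof.
move=> hy e i iN; apply: functional_extensionality_dep => v.
apply: (@gr_indep _ (A v) N (fun i => y i v)) iN => [j|]; first exact: hy.
by rewrite -gprod_sumE e.
Qed.

HB.instance Definition _ := isGradedAlg.Build k gprod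
  gprod_galg_zmod gprod_galg_monoid gprod_galgC gprod_gr0 gprod_grP gprod_gr1
  gprod_grM gprod_decomp gprod_indep.

End GradedProduct.
(* Functions on words over X that vanish on all long words, with the product
   (f g)(w) = sum over the splittings w = u v of f(u) g(v).  Both the free
   algebra on X and the algebra of inhomogeneous cochains with the cup product
   are graded subalgebras. *)
Section WordAlgebra.
Variables (X : Type) (k : fieldType).

Record wordfun := WordFun {
  word_fun :> seq X -> k ;
  word_bound : exists N, forall w, (N <= size w)%N -> word_fun w = 0 }.

Implicit Types f g h : wordfun.

Lemma wordP f g : f =1 g -> f = g.
Proof.
case: f g => [f hf] [g hg] /= /funext e; move: hf hg; rewrite e => hf hg.
by congr WordFun; exact: Prop_irrelevance.
Qed.

HB.instance Definition _ := gen_eqMixin wordfun.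
HB.instance Definition _ := gen_choiceMixin wordfun.

Definition conv (f g : seq X -> k) (w : seq X) : k :=
  \sum_(i < (size w).+1) f (take i w) * g (drop i w).

Lemma conv_nil (f g : seq X -> k) : conv f g [::] = f [::] * g [::].
Proof. by rewrite /conv big_ord1. Qed.

Lemma conv_cons (f g : seq X -> k) x w :
  conv f g (x :: w) = f [::] * g (x :: w) + conv (fun u => f (x :: u)) g w.
Proof. by rewrite /conv /= big_ord_recl. Qed.

Lemma convDl (f g h : seq X -> k) w :
  conv (fun u => f u + g u) h w = conv f h w + conv g h w.
Proof. by rewrite -big_split; apply: eq_bigr => i _; rewrite mulrDl. Qed.

Lemma convDr (f g h : seq X -> k) w :
  conv f (fun u => g u + h u) w = conv f g w + conv f h w.
Proof. by rewrite -big_split; apply: eq_bigr => i _; rewrite mulrDr. Qed.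

Lemma convZl c (f g : seq X -> k) w : conv (fun u => c * f u) g w = c * conv f g w.
Proof. by rewrite /conv big_distrr; apply: eq_bigr => i _ /=; rewrite mulrA. Qed.

Lemma convA (f g h : seq X -> k) w : conv f (conv g h) w = conv (conv f g) h w.
Proof.
elim: w f => [|x w IH] f; first by rewrite !conv_nil mulrA.
rewrite !conv_cons IH conv_nil mulrDr mulrA -addrA; congr (_ + _).
rewrite -convZl -convDl; apply: eq_bigr => i _.
by rewrite conv_cons.
Qed.

Fact word0_bound : exists N, forall w : seq X, (N <= size w)%N -> 0 = 0 :> k.
Proof. by exists 0%N. Qed.
Definition word0 := WordFun word0_bound.

Fact wordD_bound f g :
  exists N, forall w, (N <= size w)%N -> f w + g w = 0.
Proof.
have [N hN] := word_bound f; have [M hM] := word_bound g.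
exists (maxn N M) => w; rewrite geq_max => /andP[h1 h2].
by rewrite hN // hM // addr0.
Qed.
Definition wordD f g := WordFun (wordD_bound f g).

Fact wordZ_bound (c : k) f : exists N, forall w, (N <= size w)%N -> c * f w = 0.
Proof.
by have [N hN] := word_bound f; exists N => w h; rewrite hN // mulr0.
Qed.
Definition wordZ c f := WordFun (wordZ_bound c f).

Fact word1_bound :
  exists N, forall w : seq X, (N <= size w)%N -> (size w == 0%N)%:R = 0 :> k.
Proof. by exists 1%N => -[]. Qed.
Definition word1 := WordFun word1_bound.

Fact wordM_bound f g : exists N, forall w, (N <= size w)%N -> conv f g w = 0.
Proof.
have [N hN] := word_bound f; have [M hM] := word_bound g.
exists (N + M)%N => w hw; rewrite /conv big1 // => -[i /= iw] _.
have [Ni|iN] := leqP N i; first by rewrite hN ?mul0r // size_takel.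
rewrite [g _]hM ?mulr0 // size_drop leq_subRL //.
by apply: leq_trans hw; rewrite leq_add2r ltnW.
Qed.
Definition wordM f g := WordFun (wordM_bound f g).

Fact word_addA : associative wordD.
Proof. by move=> f g h; apply: wordP => w /=; rewrite addrA. Qed.
Fact word_addC : commutative wordD.
Proof. by move=> f g; apply: wordP => w /=; rewrite addrC. Qed.
Fact word_add0 : left_id word0 wordD.
Proof. by move=> f; apply: wordP => w /=; rewrite add0r. Qed.
Fact word_addN : left_inverse word0 (wordZ (-1)) wordD.
Proof. by move=> f; apply: wordP => w /=; rewrite mulN1r addNr. Qed.
HB.instance Definition _ :=
  GRing.isZmodule.Build wordfun word_addA word_addC word_add0 word_addN.

Fact word_mulA : associative wordM.
Proof. by move=> f g h; apply: wordP => w; exact: convA. Qed.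
Fact word_mul1 : left_id word1 wordM.
Proof.
move=> f; apply: wordP => -[|x w] /=; rewrite ?conv_nil ?conv_cons mul1r //.
by rewrite /conv big1 ?addr0 // => i _; rewrite mul0r.
Qed.
Fact word_mulr1 : right_id word1 wordM.
Proof.
move=> f; apply: wordP => w /=; rewrite /conv big_ord_recr /= drop_size mulr1.
rewrite take_size big1 ?add0r // => i _; rewrite size_drop subn_eq0.
by rewrite leqNgt ltn_ord mulr0.
Qed.
Fact word_mulDl : left_distributive wordM wordD.
Proof. by move=> f g h; apply: wordP => w; exact: convDl. Qed.
Fact word_mulDr : right_distributive wordM wordD.
Proof. by move=> f g h; apply: wordP => w; exact: convDr. Qed.
HB.instance Definition _ := GRing.Zmodule_isPzRing.Build wordfun
  word_mulA word_mul1 word_mulr1 word_mulDl word_mulDr.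

Lemma wordDE f g w : (f + g) w = f w + g w. Proof. by []. Qed.
Lemma wordNE f w : (- f) w = - f w. Proof. exact: mulN1r. Qed.
Lemma wordME f g w : (f * g) w = conv f g w. Proof. by []. Qed.
Lemma word_sumE N (F : nat -> wordfun) w :
  (\sum_(i < N) F i) w = \sum_(i < N) F i w.
Proof. by elim: N => [|N IH]; rewrite ?big_ord0 // !big_ord_recr /= IH. Qed.

Definition word_galg (c : k) : wordfun := wordZ c 1.
Definition word_gr (n : nat) : set wordfun :=
  [set f | forall w, size w != n -> f w = 0].

Lemma word_galgE c f w : (word_galg c * f) w = c * f w.
Proof.
have -> : word_galg c * f = wordZ c (1 * f).
  by apply: wordP => u /=; exact: convZl.
by rewrite mul1r.
Qed.

Fact word_galg_zmod : zmod_morphism word_galg.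
Proof.
by move=> a b; apply: wordP => w; rewrite wordDE wordNE /= mulrBl.
Qed.
Fact word_galg_monoid : monoid_morphism word_galg.
Proof.
split=> [|a b]; apply: wordP => w; first exact: mul1r.
by rewrite word_galgE /= mulrA.
Qed.
Fact word_galgC c f : word_galg c * f = f * word_galg c.
Proof.
apply: wordP => w; rewrite word_galgE -[f in LHS]mulr1 wordME -convZl /=.
by apply: eq_bigr => i _; rewrite -mulrA mulrCA.
Qed.
Fact word_gr0 n : word_gr n 0. Proof. by []. Qed.
Fact word_grP n c f g :
  word_gr n f -> word_gr n g -> word_gr n (word_galg c * f + g).
Proof.
by move=> hf hg w hw; rewrite wordDE word_galgE hf // hg // mulr0 addr0.
Qed.
Fact word_gr1 : word_gr 0 1.
Proof. by case. Qed.
Fact word_grM m n f g : word_gr m f -> word_gr n g -> word_gr (m + n) (f * g).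
Proof.
move=> hf hg w hw; rewrite wordME /conv big1 // => -[i /= iw] _.
have [im|im] := eqVneq i m; last by rewrite hf ?mul0r // size_takel.
rewrite [g _]hg ?mulr0 // size_drop im; apply: contra hw => /eqP <-.
by rewrite subnKC // -im.
Qed.

Fact word_part_bound n f :
  exists N, forall w, (N <= size w)%N -> (size w == n)%:R * f w = 0.
Proof.
by have [N hN] := word_bound f; exists N => w h; rewrite hN // mulr0.
Qed.
Definition word_part n f := WordFun (word_part_bound n f).

Lemma word_part_gr n f : word_gr n (word_part n f).
Proof. by move=> w /= /negbTE ->; rewrite mul0r. Qed.

Lemma word_part_sum N f : (forall w, (N <= size w)%N -> f w = 0) ->
  f = \sum_(i < N) word_part i f.
Proof.
move=> hN; apply: wordP => w; rewrite (word_sumE N (fun i => word_part i f)) /=.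
rewrite -big_distrl /=; have [/hN ->|wN] := leqP N (size w).
  by rewrite mulr0.
rewrite (bigD1 (Ordinal wN)) //= eqxx big1 ?addr0 ?mul1r // => i hi.
by rewrite eq_sym; case: eqP => // e; move: hi; rewrite -val_eqE /= e eqxx.
Qed.

Fact word_decomp f : exists N (y : nat -> wordfun),
  (forall i, word_gr i (y i)) /\ f = \sum_(i < N) y i.
Proof.
have [N hN] := word_bound f; exists N, (fun i => word_part i f).
by split; [move=> i; exact: word_part_gr|exact: word_part_sum].
Qed.
Fact word_indep N (y : nat -> wordfun) : (forall i, word_gr i (y i)) ->
  \sum_(i < N) y i = 0 -> forall i, (i < N)%N -> y i = 0.
Proof.
move=> hy e i iN; apply: wordP => w.
have [wi|wi] := eqVneq (size w) i; last exact: hy.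
have : (\sum_(j < N) y j) w = 0 by rewrite e.
rewrite word_sumE (bigD1 (Ordinal iN)) //= big1 ?addr0 // => j hj.
by apply: hy; rewrite wi eq_sym.
Qed.

HB.instance Definition _ := isGradedAlg.Build k wordfun
  word_galg_zmod word_galg_monoid word_galgC word_gr0 word_grP word_gr1
  word_grM word_decomp word_indep.

Lemma word_homogeneous (S : set wordfun) :
  (forall n f, S f -> S (word_part n f)) -> homogeneous S.
Proof.
move=> hS f Sf; have [N hN] := word_bound f; exists N, (fun i => word_part i f).
split=> [i|]; last exact: word_part_sum.
by split; [exact: word_part_gr|exact: hS].
Qed.

End WordAlgebra.

Section TensorAlgebra.
Variable (k : fieldType).

Section FreeAlgebra.
Variable (X : choiceType).

Definition fin_support : set (wordfun X k) :=
  [set f | finite_set [set w | f w != 0]].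

Fact fin_support_gsub : graded_subalgebra fin_support.
Proof.
split; last first.
  apply: word_homogeneous => n f; apply: sub_finite_set => w /=.
  by apply: contraNN => /eqP ->; rewrite mulr0.
split; [split|..].
- by apply: (sub_finite_set _ (finite_set0 _)) => w /=; rewrite eqxx.
- move=> c f g hf hg; apply: (@sub_finite_set _ _
    ([set w | f w != 0] `|` [set w | g w != 0])); last by rewrite finite_setU.
  move=> w; rewrite /mkset wordDE word_galgE => h.
  have [fw|fw] := eqVneq (f w) 0; [right|by left].
  by move: h; rewrite fw mulr0 add0r.
- apply: (sub_finite_set _ (finite_set1 [::])) => w /=.
  by case: w => //= x w; rewrite eqxx.
- move=> f g hf hg; apply: (@sub_finite_set _ _
    [set u ++ v | u in [set w | f w != 0] & v in [set w | g w != 0]]); last first.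
    exact: finite_image2.
  move=> w h; have [i hi] : exists i : 'I_(size w).+1,
      f (take i w) * g (drop i w) != 0.
    apply/existsP; apply: contraNT h; rewrite negb_exists => /forallP h.
    by rewrite /mkset wordME /conv big1 // => i _; apply/eqP; have := h i; rewrite negbK.
  move: hi; rewrite mulf_eq0 negb_or => /andP[h1 h2].
  by exists (take i w) => //; exists (drop i w) => //; rewrite cat_take_drop.
Qed.

Definition free_alg := gsub_type (GSub fin_support_gsub).

Fact free_gen_bound (x : X) : exists N, forall w : seq X,
  (N <= size w)%N -> (w == [:: x])%:R = 0 :> k.
Proof. by exists 2%N => -[|y [|z w]] // _; rewrite eqseq_cons andbF. Qed.

Fact free_gen_subproof (x : X) :
  gsub_pred (GSub fin_support_gsub) (WordFun (free_gen_bound x)).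
Proof.
apply/asboolP; apply: (sub_finite_set _ (finite_set1 [:: x])) => w.
by rewrite /mkset [word_fun _ _]/=; have [//|_] := eqVneq w [:: x]; rewrite eqxx.
Qed.

Definition free_gen (x : X) : free_alg := Sub _ (free_gen_subproof x).
End FreeAlgebra.

(* The free algebra on the set V modulo the linear relations of V. *)
Definition tensor_rel (V : lmodType k) : set (free_alg V) :=
  [set r | exists (c : k) (u v : V),
    r = free_gen (c *: u + v) - (galg c * free_gen u + free_gen v)].

Definition tensor_alg (V : lmodType k) := gquot (gen_gideal (@tensor_rel V)).

End TensorAlgebra.
HB.mixin Record isTopGroup G of Group G & Topological G := {
  mulg_continuous : continuous (fun xy : G * G => (xy.1 * xy.2)%g) ;
  invg_continuous : continuous (fun x : G => (x^-1)%g)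
}.

#[short(type="topGroupType")]
HB.structure Definition TopGroup :=
  {G of isTopGroup G & Group G & Topological G}.

Lemma discrete_continuousP (T : topologicalType) (Y : choiceType)
    (f : T -> discrete_topology Y) :
  continuous f <-> forall x, \forall y \near x, f y = f x.
Proof.
split=> h x; first exact: (h x _ (discrete_set1 (f x : discrete_topology Y))).
by apply/discrete_cvg; exact: h.
Qed.

Lemma ptws_continuousP (T : topologicalType) (I : Type) (Y : topologicalType)
    (f : T -> {ptws I -> Y}) :
  (forall i, continuous (fun t => f t i)) -> continuous f.
Proof.
move=> h t; apply/cvg_sup => i U [V [[W oW <-] WV] VU].
apply: (filterS VU); rewrite nbhs_simpl; apply: (h i t); exact: open_nbhs_nbhs.
Qed.

Lemma ptws_eval_continuous (I : Type) (Y : topologicalType) (i : I) :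
  continuous (fun x : {ptws I -> Y} => x i).
Proof. exact: (@proj_continuous {classic I} (fun=> Y) i). Qed.

Section ContinuousCochain.
Variables (G : topologicalType) (k : fieldType).

(* A cochain is given in all degrees at once, by its values on words; G^n
   carries the product topology and k the discrete one. *)
Definition continuous_cochain (f : seq G -> k) : Prop :=
  forall n, continuous ((fun x => f (codom x)) :
    {ptws 'I_n -> G} -> discrete_topology k).

Section DiscreteValued.
Variable T : topologicalType.
Local Notation dcont f := (continuous (f : T -> discrete_topology k)).

Lemma discrete_lin c (f g : T -> k) :
  dcont f -> dcont g -> dcont (fun t => c * f t + g t).
Proof.
move=> /discrete_continuousP hf /discrete_continuousP hg.
apply/discrete_continuousP => x; near=> y.
by congr (_ * _ + _); near: y; [exact: hf|exact: hg].
Unshelve. all: by end_near. Qed.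

Lemma discrete_mul (f g : T -> k) :
  dcont f -> dcont g -> dcont (fun t => f t * g t).
Proof.
move=> /discrete_continuousP hf /discrete_continuousP hg.
apply/discrete_continuousP => x; near=> y.
by congr (_ * _); near: y; [exact: hf|exact: hg].
Unshelve. all: by end_near. Qed.

Lemma discrete_cst (c : k) : dcont (fun=> c).
Proof. by apply/discrete_continuousP => x; near=> y. Unshelve. all: by end_near. Qed.

Lemma discrete_sum N (F : 'I_N -> T -> k) :
  (forall i, dcont (F i)) -> dcont (fun t => \sum_(i < N) F i t).
Proof.
move=> hF; apply/discrete_continuousP => x.
near=> y; apply: eq_bigr => i _; move: i; near: y.
by apply: filter_forall => i; have /discrete_continuousP := hF i; exact.
Unshelve. all: by end_near. Qed.
End DiscreteValued.

Lemma continuous_lin c (f g : seq G -> k) : continuous_cochain f ->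
  continuous_cochain g -> continuous_cochain (fun u => c * f u + g u).
Proof. by move=> hf hg n; exact: discrete_lin (hf n) (hg n). Qed.

Lemma continuous_size (c : nat -> k) : continuous_cochain (fun u => c (size u)).
Proof.
move=> n; rewrite (_ : (fun=> _) = fun=> c n); first exact: discrete_cst.
by apply/funext => x; rewrite size_codom card_ord.
Qed.

Lemma continuous_mul (f g : seq G -> k) : continuous_cochain f ->
  continuous_cochain g -> continuous_cochain (fun u => f u * g u).
Proof. by move=> hf hg n; exact: discrete_mul (hf n) (hg n). Qed.

Lemma continuous_sub n m (r : 'I_m -> 'I_n) (f : seq G -> k) :
  continuous_cochain f ->
  continuous ((fun x => f (codom (x \o r))) :
    {ptws 'I_n -> G} -> discrete_topology k).
Proof.
move=> hf x.
pose R : {ptws 'I_n -> G} -> {ptws 'I_m -> G} := fun y => y \o r.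
have cR : continuous R.
  by apply: ptws_continuousP => i; exact: ptws_eval_continuous.
exact: (@continuous_comp _ _ _ R _ x (cR x) (hf m (R x))).
Qed.

Let nth_codom_ord n (x : 'I_n -> G) (x0 : G) (j : 'I_n) :
  nth x0 (codom x) j = x j.
Proof.
rewrite /codom /image_mem (nth_map j) ?size_enum_ord //.
by congr x; apply: val_inj; rewrite /= nth_enum_ord.
Qed.

Let codom_mkseq n (x : 'I_n -> G) m (r : 'I_m -> 'I_n) (w : seq G) (x0 : G) :
  size w = m -> (forall i : 'I_m, nth x0 w i = x (r i)) -> w = codom (x \o r).
Proof.
move=> hs h; apply: (@eq_from_nth _ x0); first by rewrite size_codom card_ord.
by move=> i; rewrite hs => im; rewrite (h (Ordinal im)) (nth_codom_ord _ _ (Ordinal im)).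
Qed.

Lemma continuous_conv (f g : seq G -> k) : continuous_cochain f ->
  continuous_cochain g -> continuous_cochain (conv f g).
Proof.
move=> hf hg [|n].
  rewrite (_ : (fun=> _) = fun=> conv f g [::]); first exact: discrete_cst.
  apply/funext => x; congr (conv f g _); apply: size0nil.
  by rewrite size_codom card_ord.
rewrite (_ : (fun x => _) = fun x : 'I_n.+1 -> G =>
    \sum_(i < n.+2) f (take i (codom x)) * g (drop i (codom x))); last first.
  by apply/funext => x; rewrite /conv size_codom card_ord.
apply: discrete_sum => i; apply: discrete_mul.
  have lt (j : 'I_i) : (j < n.+1)%N.
    by apply: leq_trans (ltn_ord j) _; rewrite -ltnS.
  rewrite (_ : (fun x => _) = fun x : 'I_n.+1 -> G =>
    f (codom (x \o (fun j => Ordinal (lt j))))); first exact: continuous_sub.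
  apply/funext => x; congr (f _).
  apply: (@codom_mkseq _ _ _ _ _ (x ord0)).
    by rewrite size_takel // size_codom card_ord -ltnS.
  by move=> j; rewrite nth_take // (nth_codom_ord _ _ (Ordinal (lt j))).
have lt (j : 'I_(n.+1 - i)) : (i + j < n.+1)%N by rewrite -ltn_subRL.
rewrite (_ : (fun x => _) = fun x : 'I_n.+1 -> G =>
  g (codom (x \o (fun j => Ordinal (lt j))))); first exact: continuous_sub.
apply/funext => x; congr (g _).
apply: (@codom_mkseq _ _ _ _ _ (x ord0)).
  by rewrite size_drop size_codom card_ord.
by move=> j; rewrite nth_drop (nth_codom_ord _ _ (Ordinal (lt j))).
Qed.

End ContinuousCochain.

(* Inhomogeneous cochains with trivial coefficients in a (discrete) field k.
   A cochain of degree n is a function on words of size n in G. *)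
Section Cohomology.
Variables (G : topGroupType) (k : fieldType).

(* The face maps of the bar complex: face 0 deletes the first letter, face n
   deletes the last letter of a word of size n, and for 0 < i < n face i
   multiplies the i-th letter by the next one. *)
Fixpoint bar_face (i : nat) (w : seq G) {struct w} : seq G :=
  match w, i with
  | [::], _ => [::]
  | _ :: u, 0 => u
  | x :: u, i'.+1 =>
    match u, i' with
    | [::], _ => [::]
    | y :: v, 0 => (x * y)%g :: v
    | _ :: _, _ => x :: bar_face i' u
    end
  end.

Definition bar_diff (f : seq G -> k) (w : seq G) : k :=
  if w is [::] then 0
  else \sum_(i < (size w).+1) (-1) ^+ i * f (bar_face i w).

(* the terms of bar_diff other than the one of face 0 *)
Let bar_tail (f : seq G -> k) (w : seq G) : k :=
  if w is [::] then 0
  else \sum_(i < size w) (-1) ^+ i.+1 * f (bar_face i.+1 w).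

Let bar_diff_cons f x w : bar_diff f (x :: w) = f w + bar_tail f (x :: w).
Proof. by rewrite /bar_diff big_ord_recl /= expr0 mul1r. Qed.

Let bar_tail1 f x : bar_tail f [:: x] = - f [::].
Proof. by rewrite /bar_tail big_ord1 /= expr1 mulN1r. Qed.

Let bar_tail_cons f x y w : bar_tail f [:: x, y & w] =
  - f ((x * y)%g :: w) - bar_tail (fun u => f (x :: u)) (y :: w).
Proof.
rewrite /bar_tail big_ord_recl /= expr1 mulN1r; congr (_ + _).
rewrite -sumrN; apply: eq_bigr => i _ /=.
by rewrite /bump leq0n add1n exprS mulN1r mulNr.
Qed.

Definition sgn_twist (f : seq G -> k) : seq G -> k := fun w => (-1) ^+ size w * f w.

Let sgn_nil f : sgn_twist f [::] = f [::]. Proof. exact: mul1r. Qed.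

Let bar_tail_lin c (f g : seq G -> k) w :
  bar_tail (fun u => c * f u + g u) w = c * bar_tail f w + bar_tail g w.
Proof.
case: w => [|x w]; first by rewrite mulr0 addr0.
rewrite /bar_tail big_distrr -big_split; apply: eq_bigr => i _ /=.
by rewrite mulrDr mulrCA.
Qed.

Let bar_diff_lin c (f g : seq G -> k) w :
  bar_diff (fun u => c * f u + g u) w = c * bar_diff f w + bar_diff g w.
Proof.
case: w => [|x w]; first by rewrite mulr0 addr0.
rewrite /bar_diff big_distrr -big_split; apply: eq_bigr => i _ /=.
by rewrite mulrDr mulrCA.
Qed.

Let bar_tail_conv (f g : seq G -> k) x w :
  bar_tail (conv f g) (x :: w) =
  conv (bar_tail f) g (x :: w) + conv (sgn_twist f) (bar_diff g) (x :: w).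
Proof.
elim: w x f => [|y w IH] x f.
  rewrite bar_tail1 !conv_cons !conv_nil bar_tail1 sgn_nil bar_diff_cons.
  by rewrite bar_tail1 [bar_tail _ _]/= [bar_diff _ _]/=; ring.
rewrite bar_tail_cons [conv f g (_ :: w)]conv_cons.
rewrite (_ : (fun u => conv f g (x :: u)) =
  fun u => f [::] * g (x :: u) + conv (fun v => f (x :: v)) g u); last first.
  by apply/funext => u; rewrite conv_cons.
rewrite bar_tail_lin IH.
rewrite [conv (bar_tail f) g _]conv_cons mul0r add0r.
rewrite [conv (fun u => bar_tail f (x :: u)) g _]conv_cons bar_tail1.
rewrite (_ : (fun u => bar_tail f [:: x, y & u]) =
  fun u => (-1) * f ((x * y)%g :: u)
           + (-1) * bar_tail (fun v => f (x :: v)) (y :: u)); last first.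
  by apply/funext => u; rewrite bar_tail_cons !mulN1r.
rewrite convDl !convZl.
rewrite [conv (bar_tail (fun v => f (x :: v))) g _]conv_cons mul0r add0r.
rewrite [conv (sgn_twist f) _ _]conv_cons.
rewrite (_ : (fun u => sgn_twist f (x :: u)) =
  fun u => (-1) * sgn_twist (fun v => f (x :: v)) u); last first.
  by apply/funext => u; rewrite /sgn_twist /= exprS !mulrA.
rewrite convZl sgn_nil bar_diff_cons bar_tail_cons.
ring.
Qed.

Lemma bar_diff_conv (f g : seq G -> k) w :
  bar_diff (conv f g) w = conv (bar_diff f) g w + conv (sgn_twist f) (bar_diff g) w.
Proof.
case: w => [|x w]; first by rewrite !conv_nil mul0r mulr0 addr0.
rewrite bar_diff_cons bar_tail_conv addrA; congr (_ + _).
rewrite !conv_cons !mul0r !add0r -convDl; apply: eq_bigr => i _.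
by rewrite bar_diff_cons.
Qed.

Let bar_diff_sgn (f : seq G -> k) w : bar_diff (sgn_twist f) w = - sgn_twist (bar_diff f) w.
Proof.
case: w => [|x w]; first by rewrite /sgn_twist mulr0 oppr0.
rewrite /sgn_twist /bar_diff big_distrr /= -sumrN; apply: eq_bigr => i _.
have -> : size (bar_face i (x :: w)) = size w.
  elim: w x i => [|y w IH] x [[|i] hi] //=; case: i hi => [|i] //= hi.
  by rewrite (IH y (Ordinal (hi : (i.+1 < (size w).+2)%N))).
by rewrite exprS mulN1r mulNr opprK mulrCA.
Qed.

Let bar_face_size i x w : size (bar_face i (x :: w)) = size w.
Proof.
elim: w x i => [|y w IH] x [|i] //=; case: i => [|i] //=.
by rewrite (IH y i.+1).
Qed.

Let bar_diff_part n (f : wordfun G k) w :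
  bar_diff (word_part n f) w = (size w == n.+1)%:R * bar_diff f w.
Proof.
case: w => [|x w]; first by rewrite mulr0.
rewrite /bar_diff big_distrr; apply: eq_bigr => i _ /=.
by rewrite bar_face_size eqSS mulrCA.
Qed.

Fact sgn_bound (f : wordfun G k) :
  exists N, forall w, (N <= size w)%N -> sgn_twist f w = 0.
Proof.
by have [N hN] := word_bound f; exists N => w h; rewrite /sgn_twist hN // mulr0.
Qed.

Definition cocycles : set (wordfun G k) :=
  [set f | continuous_cochain f /\ forall w, bar_diff f w = 0].

Let cocycles_part n f : cocycles f -> cocycles (word_part n f).
Proof.
move=> [hc hd]; split; last by move=> w; rewrite bar_diff_part hd mulr0.
apply: (continuous_mul (f := fun w => (size w == n)%:R)) hc.
exact: (@continuous_size _ _ (fun m => (m == n)%:R)).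
Qed.

Fact cocycles_gsub : graded_subalgebra cocycles.
Proof.
split; last by apply: word_homogeneous; exact: cocycles_part.
split; [split|..].
- split=> [n|w]; first exact: discrete_cst.
  by case: w => // x w; rewrite /bar_diff big1 // => i _; exact: mulr0.
- move=> c f g [hf df] [hg dg].
  have -> : galg c * f + g = wordD (wordZ c f) g :> wordfun G k.
    by apply: wordP => w; rewrite wordDE word_galgE.
  split; first exact: continuous_lin.
  by move=> w; rewrite bar_diff_lin df dg mulr0 addr0.
- split.
    exact: (@continuous_size _ _ (fun m => (m == 0%N)%:R)).
  case=> // x [|y w]; first by rewrite bar_diff_cons bar_tail1 subrr.
  rewrite /bar_diff big1 // => i _.
  transitivity ((-1) ^+ i * (size (bar_face i [:: x, y & w]) == 0%N)%:R : k) => //.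
  by rewrite bar_face_size mulr0.
- move=> f g [hf df] [hg dg]; split; first exact: continuous_conv.
  move=> w; rewrite bar_diff_conv /conv !big1 ?addr0 // => i _.
    by rewrite dg mulr0.
  by rewrite df mul0r.
Qed.

Definition cocycle_alg := gsub_type (GSub cocycles_gsub).

Definition coboundaries : set cocycle_alg :=
  [set z | exists c : wordfun G k,
     continuous_cochain c /\ forall w, (val z : wordfun G k) w = bar_diff c w].

Fact coboundaries_gideal : graded_ideal coboundaries.
Proof.
split; [split; first split; first split|].
- exists 0; split; first by move=> n; exact: discrete_cst.
  by case=> // x w; rewrite /bar_diff big1 // => i _; exact: mulr0.
- move=> a z z' [c [hc e]] [c' [hc' e']]; exists (wordD (wordZ a c) c').
  split; first exact: continuous_lin.
  move=> w; rewrite bar_diff_lin -e -e'.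
  exact: (congr1 (fun t => t + _) (word_galgE a _ w)).
- move=> a z [c [hc e]]; have [ha da] := elimT (asboolP _) (valP a).
  pose s := wordM (WordFun (sgn_bound (val a))) c.
  exists s; split.
    apply: continuous_conv hc; apply: (continuous_mul (f := fun w => _)) ha.
    exact: (@continuous_size _ _ (fun m => (-1) ^+ m)).
  move=> w; rewrite bar_diff_conv [X in X + _](_ : _ = 0) ?add0r.
    rewrite [LHS]wordME; apply: eq_bigr => i _.
    by rewrite e /sgn_twist mulrA -expr2 sqrr_sign mul1r.
  rewrite /conv big1 // => i _.
  by rewrite bar_diff_sgn /sgn_twist da mulr0 oppr0 mul0r.
- move=> a z [c [hc e]]; have [ha da] := elimT (asboolP _) (valP a).
  exists (wordM c (val a)); split; first exact: continuous_conv.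
  move=> w; rewrite bar_diff_conv [X in _ + X](_ : _ = 0) ?addr0.
    by rewrite [LHS]wordME; apply: eq_bigr => i _; rewrite e.
  by rewrite /conv big1 // => i _; rewrite da mulr0.
- move=> z [c [hc e]]; have zP := elimT (asboolP _) (valP z).
  have [N hN] := word_bound (val z).
  pose y i : cocycle_alg :=
    Sub (word_part i (val z)) (introT (asboolP _) (cocycles_part i zP)).
  exists N, y; split; last first.
    by apply: val_inj; rewrite raddf_sum /=; exact: word_part_sum.
  move=> i; split; first exact: word_part_gr.
  case: i => [|i].
    exists 0; split; first by move=> n; exact: discrete_cst.
    case=> [|x w] /=; first by rewrite e mulr0.
    by rewrite mul0r /bar_diff big1 // => i _; exact: mulr0.
  exists (word_part i c); split; last by move=> w; rewrite bar_diff_part -e.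
  apply: (continuous_mul (f := fun w => (size w == i)%:R)) hc.
  exact: (@continuous_size _ _ (fun m => (m == i)%:R)).
Qed.

Definition cohomology := gquot (GIdeal coboundaries_gideal).

End Cohomology.
(* The quotient of a topological group G by the intersection of its open normal
   subgroups of p-power index, with the quotient topology. *)
Section MaximalProPQuotient.
Variables (p : nat) (G : topGroupType).
Local Open Scope group_scope.
Local Open Scope quotient_scope.

Definition normal_subgroup (U : set G) : Prop :=
  [/\ U 1, forall x y, U x -> U y -> U (x * y), forall x, U x -> U x^-1
    & forall x y, U x -> U (x ^ y)].

Definition left_coset (U : set G) (x : G) : set G := [set x * u | u in U].

Definition p_power_index (U : set G) : Prop :=
  exists n : nat, (range (left_coset U) #= `I_(p ^ n)%N)%card.

Definition pro_p_kernel : set G :=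
  \bigcap_(U in [set U | [/\ open U, normal_subgroup U & p_power_index U]]) U.

Fact pro_p_kernel_normal : normal_subgroup pro_p_kernel.
Proof.
split=> [U [_ [] //]|x y hx hy U hU|x hx U hU|x y hx U hU];
  case: (hU) => _ [h1 hM hV hJ] _.
- by apply: hM; [exact: hx|exact: hy].
- by apply: hV; exact: hx.
- by apply: hJ; exact: hx.
Qed.

Definition pro_p_equiv (x y : G) : bool := `[< pro_p_kernel (x^-1 * y) >].

Fact pro_p_equiv_class : equiv_class_of pro_p_equiv.
Proof.
have [h1 hM hV _] := pro_p_kernel_normal.
split=> [x|x y|y x z].
- by apply/asboolP; rewrite mulVg.
- by apply/asboolP/asboolP => /hV; rewrite invgM invgK.
- move=> /asboolP hxy /asboolP hyz; apply/asboolP.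
  by have := hM _ _ hxy hyz; rewrite mulgA mulgK.
Qed.

Canonical pro_p_equivRel := EquivRelPack pro_p_equiv_class.

Definition pro_p_quot : Type := quotient_topology {eq_quot pro_p_equiv}.
HB.instance Definition _ := Topological.on pro_p_quot.

Definition pro_p_pi : G -> pro_p_quot := \pi_{eq_quot pro_p_equiv}.
Local Notation pi := pro_p_pi.
Implicit Types u v w : pro_p_quot.

Fact pro_p_eqP x y : pi x = pi y <-> pro_p_kernel (x^-1 * y).
Proof.
split=> [/eqmodP /asboolP //|h]; by apply/eqmodP/asboolP.
Qed.

Fact pro_p_surj u : exists x, u = pi x.
Proof. by exists (repr (u : {eq_quot pro_p_equiv})); rewrite /pro_p_pi reprK. Qed.

Definition pro_p_mul u v : pro_p_quot :=
  pi (repr (u : {eq_quot pro_p_equiv}) * repr (v : {eq_quot pro_p_equiv})).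
Definition pro_p_inv u : pro_p_quot := pi (repr (u : {eq_quot pro_p_equiv}))^-1.

Let piP x y : pro_p_kernel (x^-1 * y) -> pi x = pi y.
Proof. by move=> h; exact/pro_p_eqP. Qed.

Let reprP x : pro_p_kernel ((repr (pi x : {eq_quot pro_p_equiv}))^-1 * x).
Proof. by apply/pro_p_eqP; rewrite /pro_p_pi reprK. Qed.

Fact pro_p_mulE x y : pro_p_mul (pi x) (pi y) = pi (x * y).
Proof.
have [h1 hM hV hJ] := pro_p_kernel_normal.
apply: piP; set a := repr _; set b := repr _.
have -> : (a * b)^-1 * (x * y) = (a^-1 * x) ^ b * (b^-1 * y).
  by rewrite /conjg invgM !mulgA mulgK.
by apply: hM; [apply: hJ|]; exact: reprP.
Qed.

Fact pro_p_invE x : pro_p_inv (pi x) = pi x^-1.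
Proof.
have [h1 hM hV hJ] := pro_p_kernel_normal.
apply: piP; set a := repr _; rewrite invgK.
have -> : a * x^-1 = ((a^-1 * x) ^ a^-1)^-1.
  by rewrite /conjg invgK !mulgA mulgV mul1g invgM invgK.
by apply: hV; apply: hJ; exact: reprP.
Qed.

Fact pro_p_mulA : associative pro_p_mul.
Proof.
move=> u v w; have [x ->] := pro_p_surj u; have [y ->] := pro_p_surj v.
by have [z ->] := pro_p_surj w; rewrite !pro_p_mulE mulgA.
Qed.
Fact pro_p_mul1 : left_id (pi 1) pro_p_mul.
Proof. by move=> u; have [x ->] := pro_p_surj u; rewrite pro_p_mulE mul1g. Qed.
Fact pro_p_mulg1 : right_id (pi 1) pro_p_mul.
Proof. by move=> u; have [x ->] := pro_p_surj u; rewrite pro_p_mulE mulg1. Qed.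
Fact pro_p_mulV : left_inverse (pi 1) pro_p_inv pro_p_mul.
Proof.
by move=> u; have [x ->] := pro_p_surj u; rewrite pro_p_invE pro_p_mulE mulVg.
Qed.
Fact pro_p_mulgV : right_inverse (pi 1) pro_p_inv pro_p_mul.
Proof.
by move=> u; have [x ->] := pro_p_surj u; rewrite pro_p_invE pro_p_mulE mulgV.
Qed.

HB.instance Definition _ := isGroup.Build pro_p_quot
  pro_p_mulA pro_p_mul1 pro_p_mulg1 pro_p_mulV pro_p_mulgV.

Fact pro_p_pi_continuous : continuous pi.
Proof. exact: (@pi_continuous G {eq_quot pro_p_equiv}). Qed.

Fact pro_p_pi_nbhs (x : G) (A : set G) : nbhs x A -> nbhs (pi x) (pi @` A).
Proof.
rewrite nbhsE => -[U [oU Ux] UA]; apply: (@filterS _ _ _ (pi @` U)).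
  exact: image_subset.
apply: open_nbhs_nbhs; split; last by exists x.
rewrite (_ : open _ = open (pi @^-1` (pi @` U))) //.
have [h1 hM hV hJ] := pro_p_kernel_normal.
rewrite (_ : _ @^-1` _ = \bigcup_(n in pro_p_kernel) ((fun y => y * n) @^-1` U)).
  apply: bigcup_open => n _; apply: open_comp oU => y _.
  apply: (@continuous_comp _ _ _ (fun y : G => (y, n))
    (fun xy : G * G => xy.1 * xy.2)); last exact: mulg_continuous.
  by apply: cvg_pair; [exact: cvg_id|exact: cvg_cst].
apply/seteqP; split=> [y [z Uz /pro_p_eqP h]|y [n Nn Uyn]].
  exists (y^-1 * z); last by rewrite /= mulVKg.
  by have := hV _ h; rewrite invgM invgK.
by exists (y * n) => //; apply: piP; rewrite invgM mulgVK; exact: hV.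
Qed.

Fact pro_p_mul_continuous :
  continuous (fun uv : pro_p_quot * pro_p_quot => (uv.1 * uv.2)%g).
Proof.
move=> [u v]; have [x ->] := pro_p_surj u; have [y ->] := pro_p_surj v.
move=> W; rewrite -[_.1 * _.2]/(pro_p_mul (pi x) (pi y)) pro_p_mulE => hW.
have := mulg_continuous (x, y) _ (pro_p_pi_continuous hW).
move=> [[A B] [/= hA hB] sAB].
exists (pi @` A, pi @` B); first by split; exact: pro_p_pi_nbhs.
move=> [u' v'] /= [[a Aa <-] [b Bb <-]]; have := sAB (a, b) (conj Aa Bb).
by rewrite /= -[_ * _ in X in _ -> X]/(pro_p_mul (pi a) (pi b)) pro_p_mulE.
Qed.

Fact pro_p_inv_continuous : continuous (fun u : pro_p_quot => (u^-1)%g).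
Proof.
move=> u; have [x ->] := pro_p_surj u.
move=> W; rewrite -[_^-1]/(pro_p_inv (pi x)) pro_p_invE => hW.
have := pro_p_pi_nbhs (@invg_continuous G x _ (pro_p_pi_continuous hW)).
apply: filterS => _ [a Wa <-].
by rewrite /= -[_^-1]/(pro_p_inv (pi a)) pro_p_invE.
Qed.

HB.instance Definition _ :=
  isTopGroup.Build pro_p_quot pro_p_mul_continuous pro_p_inv_continuous.

End MaximalProPQuotient.

Record sep_closure (K : fieldType) := SepClosure {
  sep_field :> fieldType ;
  sep_emb : {rmorphism K -> sep_field} ;
  sep_algebraic : forall x : sep_field, exists2 f : {poly K},
    separable_poly f & root (map_poly sep_emb f) x ;
  sep_closed : forall f : {poly sep_field},
    separable_poly f -> (1 < size f)%N -> exists x, root f x }.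

Section AbsoluteGaloisGroup.
Variables (K : fieldType) (L : sep_closure K).

(* The K-automorphisms of L, with composition and the Krull topology: the
   topology of pointwise convergence for the discrete topology of L. *)
Record abs_gal := AbsGal {
  gal_fun :> L -> L ;
  gal_zmod : zmod_morphism gal_fun ;
  gal_monoid : monoid_morphism gal_fun ;
  gal_bij : bijective gal_fun ;
  gal_fix : forall x, gal_fun (sep_emb L x) = sep_emb L x }.

Implicit Types s t : abs_gal.

Lemma galP s t : s =1 t -> s = t.
Proof.
case: s t => [s s1 s2 s3 s4] [t t1 t2 t3 t4] /= /funext e.
move: s1 s2 s3 s4 t1 t2 t3 t4; rewrite e => *.
by congr AbsGal; exact: Prop_irrelevance.
Qed.

HB.instance Definition _ := gen_eqMixin abs_gal.
HB.instance Definition _ := gen_choiceMixin abs_gal.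

Fact gal_one_bij : bijective (id : L -> L). Proof. by exists id. Qed.
Definition gal_one : abs_gal :=
  @AbsGal id (fun _ _ => erefl) (erefl, fun _ _ => erefl) gal_one_bij
    (fun _ => erefl).

Fact gal_mul_zmod s t : zmod_morphism (s \o t).
Proof. by move=> x y /=; rewrite !gal_zmod. Qed.
Fact gal_mul_monoid s t : monoid_morphism (s \o t).
Proof.
split=> [|x y] /=; first by rewrite (gal_monoid t).1 (gal_monoid s).1.
by rewrite (gal_monoid t).2 (gal_monoid s).2.
Qed.
Fact gal_mul_fix s t x : (s \o t) (sep_emb L x) = sep_emb L x.
Proof. by rewrite /= !gal_fix. Qed.
Definition gal_mul s t : abs_gal :=
  AbsGal (gal_mul_zmod s t) (gal_mul_monoid s t)
    (bij_comp (gal_bij s) (gal_bij t)) (gal_mul_fix s t).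

Fact gal_inv_ex s : exists g : L -> L, cancel s g /\ cancel g s.
Proof. by have [g h1 h2] := gal_bij s; exists g. Qed.
Definition gal_inv_fun s : L -> L := projT1 (cid (gal_inv_ex s)).
Fact gal_invK s : cancel s (gal_inv_fun s).
Proof. exact: (projT2 (cid (gal_inv_ex s))).1. Qed.
Fact gal_invKV s : cancel (gal_inv_fun s) s.
Proof. exact: (projT2 (cid (gal_inv_ex s))).2. Qed.
Let gal_inj s : injective s := can_inj (gal_invK s).

Fact gal_inv_zmod s : zmod_morphism (gal_inv_fun s).
Proof. by move=> x y; apply: (@gal_inj s); rewrite gal_zmod !gal_invKV. Qed.
Fact gal_inv_monoid s : monoid_morphism (gal_inv_fun s).
Proof.
split=> [|x y]; apply: (@gal_inj s); rewrite gal_invKV.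
  by rewrite (gal_monoid s).1.
by rewrite (gal_monoid s).2 !gal_invKV.
Qed.
Fact gal_inv_bij s : bijective (gal_inv_fun s).
Proof. by exists s; [exact: gal_invKV|exact: gal_invK]. Qed.
Fact gal_inv_fix s x : gal_inv_fun s (sep_emb L x) = sep_emb L x.
Proof. by apply: (@gal_inj s); rewrite gal_invKV gal_fix. Qed.
Definition gal_inv s : abs_gal :=
  AbsGal (gal_inv_zmod s) (gal_inv_monoid s) (gal_inv_bij s) (gal_inv_fix s).

Fact gal_mulA : associative gal_mul. Proof. by move=> s t u; exact: galP. Qed.
Fact gal_mul1 : left_id gal_one gal_mul. Proof. by move=> s; exact: galP. Qed.
Fact gal_mulg1 : right_id gal_one gal_mul. Proof. by move=> s; exact: galP. Qed.
Fact gal_mulV : left_inverse gal_one gal_inv gal_mul.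
Proof. by move=> s; apply: galP => x; exact: gal_invK. Qed.
Fact gal_mulgV : right_inverse gal_one gal_inv gal_mul.
Proof. by move=> s; apply: galP => x; exact: gal_invKV. Qed.

HB.instance Definition _ :=
  isGroup.Build abs_gal gal_mulA gal_mul1 gal_mulg1 gal_mulV gal_mulgV.

HB.instance Definition _ := Topological.copy abs_gal
  (initial_topology (gal_fun : abs_gal -> {ptws L -> discrete_topology L})).

Fact gal_nbhs s (x : L) : nbhs s [set t : abs_gal | t x = s x].
Proof.
have c1 : continuous (gal_fun : abs_gal -> {ptws L -> discrete_topology L}).
  exact: initial_continuous.
have c2 : continuous ((fun f => f x) :
  {ptws L -> discrete_topology L} -> discrete_topology L).
  exact: ptws_eval_continuous.
have := @continuous_comp _ _ _ _ _ s (c1 s) (c2 _).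
by move/(_ _ (discrete_set1 (s x : discrete_topology L))).
Qed.

Fact gal_continuous (T : topologicalType) (F : T -> abs_gal) :
  (forall a (x : L), \forall b \near a, F b x = F a x) -> continuous F.
Proof.
move=> h; apply: continuous_comp_initial.
by apply: ptws_continuousP => x; apply/discrete_continuousP => a; exact: h.
Qed.

Fact gal_mul_continuous :
  continuous (fun st : abs_gal * abs_gal => (st.1 * st.2)%g).
Proof.
apply: gal_continuous => -[s t] x.
exists ([set s' : abs_gal | s' (t x) = s (t x)],
        [set t' : abs_gal | t' x = t x]).
  by split; exact: gal_nbhs.
by move=> [s' t'] /= [hs ht]; rewrite -[LHS]/(s' (t' x)) ht hs.
Qed.

Fact gal_inv_continuous : continuous (fun s : abs_gal => (s^-1)%g).
Proof.
apply: gal_continuous => s x; have := gal_nbhs s (gal_inv s x).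
apply: filterS => t ht; apply: (@gal_inj t).
rewrite -[LHS]/(t (gal_inv_fun t x)) gal_invKV ht.
by rewrite -[RHS]/(s (gal_inv_fun s x)) gal_invKV.
Qed.

HB.instance Definition _ :=
  isTopGroup.Build abs_gal gal_mul_continuous gal_inv_continuous.

End AbsoluteGaloisGroup.

(* H^*(G_K(p), F_p); for p prime, 'F_p is the field with p elements. *)
Definition galois_cohomology (p : nat) (K : fieldType) (L : sep_closure K) :
    gralgType 'F_p :=
  cohomology (pro_p_quot p (abs_gal L)) 'F_p.
Section KoszulAlgebras.
Variables (k : fieldType) (A : gralgType k).

Definition connected_alg : Prop :=
  forall x : A, gr 0%N x -> exists! c : k, x = galg c.

Definition generated_in_degree1 : Prop :=
  gsub_set (gen_gsub (gr 1%N : set A)) = setT.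

(* A is isomorphic to T(V)/<R> with V = A_1 and R a subspace of the component of
   degree 2 of T(V). *)
Definition quadratic : Prop :=
  [/\ connected_alg, generated_in_degree1
    & exists R : set (tensor_alg (gr_piece A 1)),
        [/\ subspace R, R `<=` gr 2%N
          & exists f : A -> gquot (gen_gideal R), graded_iso f]].

Definition finite_type : Prop := fin_dim (gr 1%N : set A).

(* the left ideal A X *)
Definition left_ideal_of (X : set A) : set A :=
  [set a | exists s : seq (A * A),
     (forall u, u \in s -> X u.2) /\ a = \sum_(u <- s) u.1 * u.2].

Definition linear_left_ideal (I : set A) : Prop :=
  graded_left_ideal I /\ I = left_ideal_of (I `&` gr 1%N).

Definition colon (I : set A) (x : A) : set A := [set a | I (a * x)].

Definition universally_Koszul : Prop :=
  forall I, linear_left_ideal I ->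
  forall x, gr 1%N x -> ~ I x -> linear_left_ideal (colon I x).

Definition finite_type_universally_Koszul : Prop :=
  [/\ quadratic, finite_type & universally_Koszul].

End KoszulAlgebras.

Section AsymptoticallyKoszul.
Variables (k : fieldType) (A : gralgType k).

Section System.
Variables (I : Type) (F : I -> gsub A).

Definition filtered_system : Prop :=
  inhabited I /\ forall i j, exists l, F i `<=` F l /\ F j `<=` F l.

(* A, with the inclusions of the F i, is the colimit of the F i in graded
   algebras. *)
Definition is_colimit : Prop :=
  forall (C : gralgType k) (f : forall i, gsub_type (F i) -> C),
    (forall i, graded_hom (f i)) ->
    (forall i j (x : gsub_type (F i)) (y : gsub_type (F j)),
       F i `<=` F j -> val x = val y -> f i x = f j y) ->
  exists! g : A -> C, graded_hom g /\ forall i x, g (val x) = f i x.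

End System.

Record fd_subspace := FdSubspace {
  fd_set :> set A ;
  fd_subspaceP : subspace fd_set ;
  fd_fin_dim : fin_dim fd_set ;
  fd_degree1 : fd_set `<=` gr 1%N }.

Definition asymptotically_universally_Koszul : Prop :=
  [/\ connected_alg A, generated_in_degree1 A
    & exists (I : Type) (F : I -> gsub A),
      [/\ filtered_system F,
          forall i, [/\ quadratic (gsub_type (F i)),
            generated_in_degree1 (gsub_type (F i)),
            finite_type (gsub_type (F i))
            & universally_Koszul (gsub_type (F i))],
          is_colimit F
        & forall W : fd_subspace, exists i, W `<=` F i `&` gr 1%N]].

Definition filtered_union_universally_Koszul : Prop :=
  exists (I : Type) (F : I -> gsub A),
    [/\ filtered_system F,
        forall i, finite_type_universally_Koszul (gsub_type (F i))
      & \bigcup_i gsub_set (F i) = setT].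

End AsymptoticallyKoszul.

(* The data attached to a finite-dimensional W: the fields K_v with separable
   closures, lambda_S, B_W, phi_W, and the embedding of B_W in the product that
   identifies it with lambda_S(<W>) and phi_W with the restriction of lambda_S.
*)
Record local_data (p : nat) (A : gralgType 'F_p) (W : set A) := LocalData {
  ld_place : finType ;
  ld_field : ld_place -> fieldType ;
  ld_sep : forall v, sep_closure (ld_field v) ;
  ld_prod := gprod (fun v => galois_cohomology p (ld_sep v)) ;
  ld_lambda : A -> ld_prod ;
  ld_lambda_hom : graded_hom ld_lambda ;
  ld_alg : gralgType 'F_p ;
  ld_alg_Koszul : finite_type_universally_Koszul ld_alg ;
  ld_phi : gsub_type (gen_gsub W) -> ld_alg ;
  ld_phi_iso : graded_iso ld_phi ;
  ld_emb : ld_alg -> ld_prod ;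
  ld_emb_hom : graded_hom ld_emb ;
  ld_emb_inj : injective ld_emb ;
  ld_phi_induced : forall x, ld_emb (ld_phi x) = ld_lambda (val x) }.

(* Main.v *)
(* The subalgebras <W>, for W a finite-dimensional subspace of A_1, form a
   directed system, because <W> and <W'> lie in <W + W'>, and their union is A
   because A is generated in degree 1.  A directed union of graded subalgebras
   is their colimit.  Since phi_W is a graded isomorphism, each <W> inherits from
   B_W that it is quadratic, of finite type and universally Koszul; for the
   quadratic presentation, the relations are pulled back along the isomorphism
   of tensor algebras induced by the isomorphism of degree 1 components. *)

Require Import Defs.
From HB Require Import structures.
From mathcomp Require Import all_boot all_algebra.
From mathcomp Require Import boolp classical_sets cardinality.

Set Implicit Arguments.
Unset Strict Implicit.
Unset Printing Implicit Defensive.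

Import GRing.Theory.
Local Open Scope classical_set_scope.
Local Open Scope ring_scope.

(** * Graded homomorphisms and preimages of graded structures *)

Section GradedHomTheory.
Variables (k : fieldType) (A B : gralgType k) (f : A -> B).
Hypothesis hf : graded_hom f.

Let hfB : zmod_morphism f. Proof. by case: hf. Qed.
Let hfM : monoid_morphism f. Proof. by case: hf. Qed.
Let F : {rmorphism A -> B} := HB.pack f
  (GRing.isZmodMorphism.Build A B f hfB) (GRing.isMonoidMorphism.Build A B f hfM).

Lemma ghom0 : f 0 = 0. Proof. exact: (rmorph0 F). Qed.
Lemma ghom1 : f 1 = 1. Proof. exact: (rmorph1 F). Qed.
Lemma ghomD x y : f (x + y) = f x + f y. Proof. exact: (rmorphD F). Qed.
Lemma ghomB x y : f (x - y) = f x - f y. Proof. exact: (rmorphB F). Qed.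
Lemma ghomM x y : f (x * y) = f x * f y. Proof. exact: (rmorphM F). Qed.
Lemma ghomC c : f (galg c) = galg c. Proof. by case: hf. Qed.
Lemma ghom_gr n x : gr n x -> gr n (f x). Proof. by case: hf => _ _ _; exact. Qed.
Lemma ghom_sum I (r : seq I) (G : I -> A) :
  f (\sum_(i <- r) G i) = \sum_(i <- r) f (G i).
Proof. exact: (rmorph_sum F). Qed.
Lemma ghomP c x y : f (galg c * x + y) = galg c * f x + f y.
Proof. by rewrite ghomD ghomM ghomC. Qed.

Lemma subspace_preimage S : subspace S -> subspace (f @^-1` S).
Proof.
move=> [S0 SP]; split=> [|c x y Sx Sy]; rewrite /preimage /= ?ghom0 //.
by rewrite ghomP; exact: SP.
Qed.

(** The components of [x] are sent to those of [f x], which lie in the homogeneous set [S]. *)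
Lemma homogeneous_preimage S : S 0 -> homogeneous S -> homogeneous (f @^-1` S).
Proof.
move=> S0 hS x Sx; have [N [y [hy e]]] := gr_decomp x.
(* Past [N] the terms [y i] do not occur in the sum and may map outside [S], so they are replaced by
   0. *)
exists N, (fun i => if (i < N)%N then y i else 0); split; last first.
  by rewrite e; apply: eq_bigr => i _; rewrite ltn_ord.
move=> i; case: ifP => iN; last by split; [exact: gr0|rewrite /preimage /= ghom0].
split=> //; apply: (@homogeneous_comp _ _ S N (f \o y)) iN => //= [j|].
  exact: ghom_gr.
by rewrite -ghom_sum -e.
Qed.

Lemma graded_subalgebra_preimage S :
  graded_subalgebra S -> graded_subalgebra (f @^-1` S).
Proof.
move=> [[Ss S1 SM] Sh]; split; last exact: homogeneous_preimage Ss.1 Sh.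
split; [exact: subspace_preimage|by rewrite /preimage /= ghom1|].
by move=> x y Sx Sy; rewrite /preimage /= ghomM; exact: SM.
Qed.

Lemma graded_left_ideal_preimage S :
  graded_left_ideal S -> graded_left_ideal (f @^-1` S).
Proof.
move=> [[Ss SM] Sh]; split; last exact: homogeneous_preimage Ss.1 Sh.
split; first exact: subspace_preimage.
by move=> a x Sx; rewrite /preimage /= ghomM; exact: SM.
Qed.

Lemma graded_ideal_preimage S : graded_ideal S -> graded_ideal (f @^-1` S).
Proof.
move=> [[Sl SM] Sh].
have [hl hh] := graded_left_ideal_preimage (conj Sl Sh).
split=> //; split=> // a x Sx; rewrite /preimage /= ghomM; exact: SM.
Qed.

End GradedHomTheory.

Lemma graded_hom_comp (k : fieldType) (A B C : gralgType k)
    (f : A -> B) (g : B -> C) :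
  graded_hom f -> graded_hom g -> graded_hom (g \o f).
Proof.
move=> hf hg; split=> [x y||c|n x] /=; last by move=> /(ghom_gr hf)/(ghom_gr hg).
- by rewrite !ghomB.
- by split=> [|x y] /=; rewrite ?(ghom1 hf) ?(ghom1 hg) ?(ghomM hf) ?(ghomM hg).
- by rewrite (ghomC hf) (ghomC hg).
Qed.

Lemma graded_iso_comp (k : fieldType) (A B C : gralgType k)
    (f : A -> B) (g : B -> C) :
  graded_iso f -> graded_iso g -> graded_iso (g \o f).
Proof.
by move=> [hf bf] [hg bg]; split; [exact: graded_hom_comp|exact: bij_comp].
Qed.

(** * Graded isomorphisms and generated structures *)

Section GradedIso.
Variables (k : fieldType) (A B : gralgType k) (f : A -> B).
Hypothesis isof : graded_iso f.
Let hf : graded_hom f := isof.1.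
Let injf : injective f := bij_inj isof.2.

(** By uniqueness of components in [B], each component of [x] of degree other than [n] maps to 0,
    hence vanishes by injectivity. This is what makes the inverse of [f] graded. *)
Lemma graded_iso_gr n x : gr n (f x) -> gr n x.
Proof.
move=> hx; have [N [y [hy e]]] := gr_decomp x.
(* A second decomposition of [f x], concentrated in degree [n], to be compared with the images of
   the [y i]. *)
pose z i := if i == n then f x else 0.
have hz i : gr i (z i) by rewrite /z; case: eqP => [->|_] //; exact: gr0.
have es : \sum_(i < N) f (y i) = \sum_(i < n.+1) z i.
  rewrite -(ghom_sum hf) -e big_ord_recr /= big1 ?add0r ?/z ?eqxx // => i _.
  by rewrite (ltn_eqF (ltn_ord i)).
have u := gr_uniq (fun i => ghom_gr hf (hy i)) hz es.
rewrite e; apply: (big_ind (gr n)) => [|a b|i _]; [exact: gr0|exact: grD|].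
have [<-//|ni] := eqVneq (i : nat) n.
suff -> : y i = 0 by exact: gr0.
apply: injf; rewrite (ghom0 hf).
by have := u i; rewrite ltn_ord /z (negbTE ni) => ->; case: ifP.
Qed.

Lemma graded_iso_inv : exists g : B -> A,
  [/\ graded_iso g, cancel f g & cancel g f].
Proof.
have [g fg gf] := isof.2; exists g; split=> //; split; last by exists f.
split=> [x y||c|n x hx].
- by apply: injf; rewrite (ghomB hf) !gf.
- by split=> [|x y]; apply: injf; rewrite ?(ghom1 hf) ?(ghomM hf) !gf.
- by apply: injf; rewrite (ghomC hf) gf.
- by apply: graded_iso_gr; rewrite gf.
Qed.

(** Each inclusion tests a smallest set against a preimage, along [f] for one and along its inverse
    for the other. The closure properties are left abstract to cover both ideals and subalgebras. *)
Lemma smallest_preimage (PA : set (set A)) (PB : set (set B)) (G : set B) :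
    (forall S, PB S -> PA (f @^-1` S)) ->
    (forall g : B -> A, graded_hom g -> forall S, PA S -> PB (g @^-1` S)) ->
  smallest PA (f @^-1` G) = f @^-1` smallest PB G.
Proof.
move=> hAB hBA; have [g [[hg _] fg gf]] := graded_iso_inv.
apply/seteqP; split=> x hx.
  by move=> S [PS GS]; apply: (hx (f @^-1` S)); split; [exact: hAB|move=> y /GS].
move=> S [PS GS]; rewrite -(fg x); apply: (hx (g @^-1` S)).
split; first exact: hBA.
by move=> y Gy; apply: GS; rewrite /preimage /= gf.
Qed.

Lemma gen_gideal_preimage (R : set B) :
  gen_gideal (f @^-1` R) = f @^-1` gen_gideal R :> set A.
Proof.
apply: smallest_preimage => [S|g hg S]; exact: graded_ideal_preimage.
Qed.

Lemma gen_gsub_preimage (R : set B) :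
  gen_gsub (f @^-1` R) = f @^-1` gen_gsub R :> set A.
Proof.
apply: smallest_preimage => [S|g hg S]; exact: graded_subalgebra_preimage.
Qed.

Lemma gr_preimage n : f @^-1` gr n = gr n.
Proof.
by apply/seteqP; split=> x; [exact: graded_iso_gr|exact: ghom_gr].
Qed.

(** Combinations of elements of the generating set are carried over term by term, by [f] in one
    direction and by its inverse in the other. *)
Lemma left_ideal_of_preimage (X : set B) :
  left_ideal_of (f @^-1` X) = f @^-1` left_ideal_of X.
Proof.
have [g [[hg _] fg gf]] := graded_iso_inv.
apply/seteqP; split=> x [s [hs e]].
  exists [seq (f u.1, f u.2) | u <- s]; split.
    by move=> _ /mapP[u us ->]; exact: hs.
  by rewrite big_map e (ghom_sum hf); apply: eq_bigr => u _; rewrite (ghomM hf).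
exists [seq (g u.1, g u.2) | u <- s]; split.
  by move=> _ /mapP[u us ->]; rewrite /preimage /= gf; exact: hs.
rewrite -[x]fg e big_map (ghom_sum hg).
by apply: eq_bigr => u _; rewrite (ghomM hg).
Qed.

Lemma linear_left_ideal_preimage I :
  linear_left_ideal I -> linear_left_ideal (f @^-1` I).
Proof.
move=> [gI eI]; split; first exact: graded_left_ideal_preimage.
by rewrite -gr_preimage -preimage_setI left_ideal_of_preimage -eI.
Qed.

End GradedIso.

(** * Isomorphisms of quotients by generated ideals *)

Section QuotientIso.
Variables (k : fieldType) (A B : gralgType k) (f : A -> B).
Hypothesis isof : graded_iso f.
Let hf : graded_hom f := isof.1.

(** The ideal generated by [R] is the preimage of the one generated by [R'], so [f] descends to the
    quotients. *)
Lemma gquot_gen_iso (R : set A) (R' : set B) : R = f @^-1` R' ->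
  exists h : gquot (gen_gideal R) -> gquot (gen_gideal R'), graded_iso h.
Proof.
move=> eR.
have eI : gen_gideal R = f @^-1` gen_gideal R' :> set A.
  by rewrite eR; exact: gen_gideal_preimage.
have [g [_ _ gf]] := graded_iso_inv isof.
pose pA := @gquot_pi k A (gen_gideal R).
pose pB := @gquot_pi k B (gen_gideal R').
(* From left to right this makes the induced map well defined; from right to left it makes it
   injective. *)
have pE x y : pA x = pA y <-> pB (f x) = pB (f y).
  by rewrite !gquot_eqP eI /preimage /= (ghomB hf).
have /choice[h hP] : forall u, exists v, forall x, u = pA x -> v = pB (f x).
  by move=> u; have [x ->] := gquot_surj u; exists (pB (f x)) => y /pE.
have hE x : h (pA x) = pB (f x) by exact: hP.
have pBD : zmod_morphism pB by exact: gquot_piB.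
exists h; split; last first.
  have injh : injective h.
    move=> u v; have [x ->] := gquot_surj u; have [y ->] := gquot_surj v.
    by rewrite !hE => /pE.
  have /choice[h' h'P] : forall v, exists u, h u = v.
    move=> v; have [y ->] := gquot_surj v; exists (pA (g y)).
    by rewrite hE gf.
  by exists h' => u; [apply: injh|]; rewrite h'P.
split=> [u v||c|n _ [x hx <-]].
- have [x ->] := gquot_surj u; have [y ->] := gquot_surj v.
  rewrite -[LHS]/(h (pA x - pA y)) -[pA x - pA y]gquot_piB.
  by rewrite [LHS]hE (ghomB hf) pBD -!hE.
- split=> [|u v].
    by rewrite -[LHS]/(h (pA 1)) hE (ghom1 hf).
  have [x ->] := gquot_surj u; have [y ->] := gquot_surj v.
  rewrite -[LHS]/(h (gquot_mul (pA x) (pA y))) gquot_mulE [LHS]hE (ghomM hf).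
  by rewrite (hE x) (hE y) -[LHS]gquot_mulE.
- by rewrite -[LHS]/(h (pA (galg c))) hE (ghomC hf).
- by rewrite -[h _]/(h (pA x)) hE; exists (f x) => //; exact: ghom_gr.
Qed.

End QuotientIso.

(** * Functoriality of free and tensor algebras *)

Section RelabelWords.
Variables (k : fieldType) (X Y : choiceType) (e : X -> Y) (e' : Y -> X).
Hypotheses (eK : cancel e e') (e'K : cancel e' e).

Fact relabel_bound (f : wordfun X k) :
  exists N, forall w, (N <= size w)%N -> f (map e' w) = 0.
Proof.
by have [N hN] := word_bound f; exists N => w hw; rewrite hN ?size_map.
Qed.

(** Functions on words are contravariant in the alphabet, so the covariant map along [e] is
    composition with the inverse [e']. *)
Definition relabel (f : wordfun X k) : wordfun Y k := WordFun (relabel_bound f).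

Lemma relabel_hom : graded_hom relabel.
Proof.
split=> [f g||c|n f hf w hw].
- by apply: wordP => w.
- split=> [|f g]; apply: wordP => w; first by rewrite /= size_map.
  rewrite wordME /= /conv size_map.
  by apply: eq_bigr => i _ /=; rewrite map_take map_drop.
- by apply: wordP => w; rewrite /= size_map.
- by apply: hf; rewrite size_map.
Qed.

(** The new support lies in the image of the old one under [map e], hence is finite. *)
Fact relabel_free_subproof (f : free_alg k X) :
  gsub_pred (GSub (@fin_support_gsub k Y)) (relabel (val f)).
Proof.
apply/asboolP; have := elimT (asboolP _) (valP f).
move=> /(finite_image (map e)); apply: sub_finite_set => w hw.
by exists (map e' w) => //; rewrite -map_comp map_id_in // => x _; exact: e'K.
Qed.

Definition relabel_free (f : free_alg k X) : free_alg k Y :=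
  Sub _ (relabel_free_subproof f).

Lemma relabel_free_hom : graded_hom relabel_free.
Proof.
split=> [f g||c|n f]; last by move=> /(ghom_gr relabel_hom).
- by apply: val_inj; exact: (ghomB relabel_hom).
- split=> [|f g]; apply: val_inj; first exact: (ghom1 relabel_hom).
  exact: (ghomM relabel_hom).
- by apply: val_inj; exact: (ghomC relabel_hom).
Qed.

Lemma relabel_free_gen x : relabel_free (free_gen k x) = free_gen k (e x).
Proof.
apply: val_inj; apply: wordP => w /=; congr (nat_of_bool _)%:R.
case: w => [|y [|z w]] //=; last by rewrite !eqseq_cons !andbF.
by rewrite !eqseq_cons !andbT (can2_eq e'K eK).
Qed.

End RelabelWords.

Section TensorFunctor.
Variables (k : fieldType) (V W : lmodType k) (e : V -> W).

(** Relabelling letters by [e] is an isomorphism of free algebras; since [e] is linear, it matches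
    the linear relations of [V] with those of [W]. *)
Lemma tensor_alg_iso : linear e -> bijective e ->
  exists f : tensor_alg V -> tensor_alg W, graded_iso f.
Proof.
move=> le [e' eK e'K].
pose f := relabel_free (k := k) e'K.
have fE c u v : f (free_gen k (c *: u + v) -
    (galg c * free_gen k u + free_gen k v)) =
    free_gen k (c *: e u + e v) -
    (galg c * free_gen k (e u) + free_gen k (e v)).
  have hf : graded_hom f by exact: relabel_free_hom.
  by rewrite (ghomB hf) (ghomP hf) /f !(relabel_free_gen k eK) le.
have fK : cancel f (relabel_free eK).
  move=> x; apply: val_inj; apply: wordP => w /=.
  by rewrite -map_comp map_id_in // => y _; exact: eK.
have fK' : cancel (relabel_free eK) f.
  move=> x; apply: val_inj; apply: wordP => w /=.
  by rewrite -map_comp map_id_in // => y _; exact: e'K.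
apply: (@gquot_gen_iso _ _ _ f).
  by split; [exact: relabel_free_hom|exists (relabel_free eK)].
apply/seteqP; split=> [_ [c [u [v ->]]]|x [c [u [v]]]].
  by exists c, (e u), (e v); rewrite fE.
(* With [u] and [v] written as values of [e], a relation of [W] is the image of a relation of [V],
   and injectivity of [f] identifies [x] with the latter. *)
rewrite -(e'K u) -(e'K v) -fE => /(can_inj fK) ->.
by exists c, (e' u), (e' v).
Qed.

End TensorFunctor.

(** * Transport of the Koszul properties along isomorphisms *)

Lemma gr_piece_iso (k : fieldType) (A B : gralgType k) (f : A -> B) n :
  graded_iso f ->
  exists2 e : gr_piece A n -> gr_piece B n, linear e & bijective e.
Proof.
move=> isof; have [g [[hg _] fg gf]] := graded_iso_inv isof.
have hf := isof.1.
have fP (x : gr_piece A n) : gr_pred n (f (val x)).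
  by apply/asboolP/(ghom_gr hf)/asboolP; exact: valP x.
have gP (x : gr_piece B n) : gr_pred n (g (val x)).
  by apply/asboolP/(ghom_gr hg)/asboolP; exact: valP x.
exists (fun x => Sub (f (val x)) (fP x)).
  by move=> c u v; apply: val_inj; exact: (ghomP hf).
exists (fun x => Sub (g (val x)) (gP x)) => x; apply: val_inj => /=.
  exact: fg.
exact: gf.
Qed.

Section KoszulTransport.
Variables (k : fieldType) (A B : gralgType k) (f : A -> B).
Hypothesis isof : graded_iso f.
Let hf : graded_hom f := isof.1.
Let injf : injective f := bij_inj isof.2.

Lemma connected_alg_iso : connected_alg B -> connected_alg A.
Proof.
move=> cB x /(ghom_gr hf)/cB [c [fx uc]]; exists c; split.
  by apply: injf; rewrite (ghomC hf).
by move=> c' xc; apply: uc; rewrite xc (ghomC hf).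
Qed.

Lemma generated_in_degree1_iso :
  generated_in_degree1 B -> generated_in_degree1 A.
Proof.
rewrite /generated_in_degree1 => gB.
by rewrite -(gr_preimage isof) gen_gsub_preimage // gB preimage_setT.
Qed.

Lemma quadratic_iso : quadratic B -> quadratic A.
Proof.
move=> [cB gB [R [sR R2 [h isoh]]]]; split.
- exact: connected_alg_iso.
- exact: generated_in_degree1_iso.
have [e le be] := gr_piece_iso 1 isof.
have [t isot] := tensor_alg_iso le be.
have [q isoq] := gquot_gen_iso isot (erefl (t @^-1` R)).
have [q' [isoq' _ _]] := graded_iso_inv isoq.
exists (t @^-1` R); split.
- exact: subspace_preimage isot.1 _ sR.
- by move=> x /R2; exact: graded_iso_gr.
(* The route is from [A] to [B], then to the presentation of [B], then back along the inverse of [q]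
   to the quotient of the tensor algebra of the degree 1 part of [A]. *)
- exists (q' \o (h \o f)); apply: graded_iso_comp => //.
  exact: graded_iso_comp.
Qed.

Lemma finite_type_iso : finite_type B -> finite_type A.
Proof.
move=> [s es]; have [g [[hg _] fg gf]] := graded_iso_inv isof.
have gE (c : nat -> k) : \sum_(i < size s) galg (c i) * (map g s)`_i =
    g (\sum_(i < size s) galg (c i) * s`_i).
  rewrite (ghom_sum hg); apply: eq_bigr => i _.
  by rewrite (ghomM hg) (ghomC hg) (nth_map 0).
exists (map g s); rewrite -(gr_preimage isof) es size_map.
apply/seteqP; split=> x [c]; rewrite ?gE => e; exists c.
  by rewrite gE -e fg.
by rewrite e gf.
Qed.

Lemma universally_Koszul_iso : universally_Koszul B -> universally_Koszul A.
Proof.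
move=> uB I lI x x1 nIx; have [g [isog fg gf]] := graded_iso_inv isof.
have hg := isog.1.
(* The preimage of [I] under the inverse [g] is the image of [I] in [B]; the colon ideal is formed
   there and pulled back. *)
rewrite (_ : colon I x = f @^-1` colon (g @^-1` I) (f x)).
  apply: (linear_left_ideal_preimage isof).
  apply: uB; first exact: linear_left_ideal_preimage.
    exact: ghom_gr.
  by rewrite /preimage /= fg.
by rewrite predeqE => a; rewrite /colon /preimage /= (ghomM hg) !fg.
Qed.

Lemma finite_type_universally_Koszul_iso :
  finite_type_universally_Koszul B -> finite_type_universally_Koszul A.
Proof.
move=> [qB fB uB]; split; [exact: quadratic_iso|exact: finite_type_iso|].
exact: universally_Koszul_iso.
Qed.

End KoszulTransport.

(** * Directed unions of graded subalgebras *)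

Section DirectedUnion.
Variables (k : fieldType) (A : gralgType k) (I : Type) (F : I -> gsub A).
Hypothesis fF : filtered_system F.

(** Any two elements lie in a common member, where they can be combined; a single element is
    decomposed into components inside its own member. *)
Lemma directed_union_subalgebra : graded_subalgebra (\bigcup_i gsub_set (F i)).
Proof.
have [[i0] dF] := fF.
split; last first.
  move=> x [i _ Fx]; have [_ hF] := gsubP (F i).
  have [N [y [hy e]]] := hF x Fx; exists N, y; split=> // j.
  by split; [exact: (hy j).1|exists i => //; exact: (hy j).2].
have [[[F0 _] F1 _] _] := gsubP (F i0).
split; [split; [by exists i0|]|by exists i0|].
  move=> c x y [i _ Fx] [j _ Fy]; have [l [il jl]] := dF i j.
  have [[[_ FP] _ _] _] := gsubP (F l).
  by exists l => //; apply: FP; [exact: il|exact: jl].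
move=> x y [i _ Fx] [j _ Fy]; have [l [il jl]] := dF i j.
have [[_ _ FM] _] := gsubP (F l).
by exists l => //; apply: FM; [exact: il|exact: jl].
Qed.

Lemma directed_union_colimit : \bigcup_i gsub_set (F i) = setT -> is_colimit F.
Proof.
move=> FT C f hf fc; have [_ dF] := fF.
have cover x : exists i, gsub_set (F i) x.
  by have : setT x by []; rewrite -FT => -[i _ Fx]; exists i.
have cover2 x y : exists i, gsub_set (F i) x /\ gsub_set (F i) y.
  have [i Fx] := cover x; have [j Fy] := cover y.
  by have [l [il jl]] := dF i j; exists l; split; [exact: il|exact: jl].
pose el i x (Fx : gsub_set (F i) x) : gsub_type (F i) := Sub x (introT (asboolP _) Fx).
(* The value does not depend on the member containing [x]: two choices both agree with the value at
   a common upper bound. *)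
have /choice[g gP] : forall x, exists z, forall i (Fx : gsub_set (F i) x), z = f i (el i x Fx).
  move=> x; have [i Fx] := cover x; exists (f i (el i x Fx)) => j Fx'.
  have [l [il jl]] := dF i j.
  transitivity (f l (el l x (il x Fx))); first exact: fc.
  by apply/esym; exact: fc.
have gE i (x : gsub_type (F i)) : g (val x) = f i x.
  have Fx : gsub_set (F i) (val x) := elimT (asboolP _) (valP x).
  by rewrite (gP _ i Fx); congr f; exact: val_inj.
exists g; split; last first.
  move=> g' [_ g'E]; apply/funext => x; have [i Fx] := cover x.
  by rewrite (gP x i Fx) -g'E.
split=> //; split=> [x y||c|n x xn].
- have [i [Fx Fy]] := cover2 x y.
  by rewrite (gP x i Fx) (gP y i Fy) -(ghomB (hf i)) -gE.
- split=> [|x y].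
    (* Every member contains the unit; [cover 0] only supplies an index. *)
    have [i _] := cover 0.
    by rewrite -[1]/(val (1 : gsub_type (F i))) gE (ghom1 (hf i)).
  have [i [Fx Fy]] := cover2 x y.
  by rewrite (gP x i Fx) (gP y i Fy) -(ghomM (hf i)) -gE.
- have [i _] := cover 0.
  by rewrite -(ghomC (hf i)) -gE.
- by have [i Fx] := cover x; rewrite (gP x i Fx); exact: (ghom_gr (hf i)).
Qed.

(** The scalars of a member are those of [A], so both existence and uniqueness of the scalar can be
    checked in a member containing [x]. *)
Lemma directed_union_connected : \bigcup_i gsub_set (F i) = setT ->
  (forall i, connected_alg (gsub_type (F i))) -> connected_alg A.
Proof.
move=> FT cF x x0; have : setT x by []; rewrite -FT => -[i _ Fx].
pose y : gsub_type (F i) := Sub x (introT (asboolP _) Fx).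
have [c [yc uc]] := cF i y x0.
exists c; split; first exact: (congr1 val yc).
by move=> c' xc; apply: uc; exact: val_inj.
Qed.

End DirectedUnion.

(** * Finite-dimensional subspaces of the degree 1 component *)

Section FiniteDimensional.
Variables (k : fieldType) (A : gralgType k).

Lemma span_subspace (s : seq A) : subspace
  [set x | exists c : nat -> k, x = \sum_(i < size s) galg (c i) * s`_i].
Proof.
split.
  by exists (fun=> 0); rewrite big1 // => i _; rewrite raddf0 mul0r.
move=> a _ _ [c ->] [d ->]; exists (fun i => a * c i + d i).
rewrite big_distrr -big_split; apply: eq_bigr => i _ /=.
by rewrite rmorphD rmorphM mulrDl mulrA.
Qed.

Lemma sum_degree1 (s : seq A) (c : nat -> k) :
    (forall i, gr 1%N (s`_i)) ->
  gr 1%N (\sum_(i < size s) galg (c i) * s`_i).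
Proof.
move=> hs; apply: (big_ind (gr 1%N)) => [|x y|i _]; first exact: gr0.
  exact: grD.
exact: grZ.
Qed.

(** The index in [hs] is unbounded because the default value 0 also has degree 1. The construction
    is transparent, so that membership unfolds to an explicit linear combination. *)
Definition span_fd (s : seq A) (hs : forall i, gr 1%N (s`_i)) : fd_subspace A.
Proof.
apply: (FdSubspace (span_subspace s)); first by exists s.
by move=> _ [c ->]; exact: sum_degree1.
Defined.

Lemma fd_subspace_mem x : gr 1%N x -> exists W : fd_subspace A, fd_set W x.
Proof.
move=> hx; have hs i : gr 1%N ([:: x]`_i).
  by case: i => [|[|i]] //=; exact: gr0.
exists (span_fd hs); exists (fun=> 1).
by rewrite big_ord1 rmorph1 mul1r.
Qed.

(** Concatenating spanning lists of both subspaces gives a spanning list of their sum. *)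
Lemma fd_subspace_join (W W' : fd_subspace A) :
  exists U : fd_subspace A, W `<=` U /\ W' `<=` U.
Proof.
(* [fin_dim] does not say that the spanning vectors have degree 1. Each one is a combination with a
   single coefficient 1, so it lies in [V] and thus in degree 1. *)
have nth_degree1 (V : fd_subspace A) s : fd_set V =
    [set x | exists c : nat -> k, x = \sum_(i < size s) galg (c i) * s`_i] ->
    forall i, gr 1%N (s`_i).
  move=> eV i; have [si|ilt] := leqP (size s) i.
    by rewrite nth_default //; exact: gr0.
  apply: (fd_degree1 (f := V)); rewrite eV; exists (fun j => (j == i)%:R).
  rewrite (bigD1 (Ordinal ilt)) //= eqxx rmorph1 mul1r big1 ?addr0 // => j.
  by rewrite -val_eqE /= => /negbTE ->; rewrite raddf0 mul0r.
have [s es] := fd_fin_dim W; have [t et] := fd_fin_dim W'.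
have hst i : gr 1%N ((s ++ t)`_i).
  rewrite nth_cat; case: ifP => _.
    exact: (nth_degree1 _ _ es).
  exact: (nth_degree1 _ _ et).
exists (span_fd hst); split=> x.
  rewrite es => -[c ->]; exists (fun i => if (i < size s)%N then c i else 0).
  rewrite size_cat big_split_ord /= [X in _ + X]big1 ?addr0 => [|i _].
    by apply: eq_bigr => i _; rewrite nth_cat ltn_ord.
  by rewrite ltnNge leq_addr raddf0 mul0r.
rewrite et => -[c ->].
(* The coefficients are shifted past the block belonging to [s]. *)
exists (fun i => if (i < size s)%N then 0 else c (i - size s)%N).
rewrite size_cat big_split_ord /= [X in X + _]big1 ?add0r => [|i _].
  apply: eq_bigr => i _.
  by rewrite nth_cat ltnNge leq_addr /= addKn.
by rewrite ltn_ord raddf0 mul0r.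
Qed.

End FiniteDimensional.

(** * The system of subalgebras generated by finite-dimensional subspaces *)

Lemma sub_gen_gsub (k : fieldType) (A : gralgType k) (W : set A) :
  W `<=` gen_gsub W.
Proof. by move=> x Wx S [_ WS]; exact: WS. Qed.

Lemma gen_gsub_mono (k : fieldType) (A : gralgType k) (W W' : set A) :
  W `<=` W' -> gen_gsub W `<=` gen_gsub W'.
Proof.
by move=> WW' x Wx S [PS W'S]; apply: Wx; split=> // y /WW' /W'S.
Qed.

Section FiniteDimensionalSystem.
Variables (k : fieldType) (A : gralgType k).
Let F (W : fd_subspace A) : gsub A := gen_gsub W.

Lemma fd_gen_filtered : filtered_system F.
Proof.
(* The span of 0 shows that the index type is inhabited. *)
split; first by have [W _] := fd_subspace_mem (gr0 1%N : gr 1%N (0 : A)).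
move=> W W'; have [U [WU W'U]] := fd_subspace_join W W'.
by exists U; split; exact: gen_gsub_mono.
Qed.

(** The union is a graded subalgebra, and it contains each degree 1 element because such an element
    spans an admissible [W]. So it contains the subalgebra generated in degree 1. *)
Lemma fd_gen_union : generated_in_degree1 A -> \bigcup_W gsub_set (F W) = setT.
Proof.
move=> g1; apply/seteqP; split=> // x _.
have : gsub_set (gen_gsub (gr 1%N : set A)) x by rewrite g1.
apply; split; first exact: directed_union_subalgebra fd_gen_filtered.
move=> y /fd_subspace_mem[W Wy]; exists W => //; exact: sub_gen_gsub.
Qed.

Lemma fd_gen_asymptotically_universally_Koszul : generated_in_degree1 A ->
    (forall W, finite_type_universally_Koszul (gsub_type (F W))) ->
  filtered_union_universally_Koszul A /\ asymptotically_universally_Koszul A.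
Proof.
move=> g1 KF; have fF := fd_gen_filtered; have FT := fd_gen_union g1.
split; first by exists (fd_subspace A), F.
(* Connectedness of [A] is read off from the members, which are connected because they are
   quadratic. *)
split=> //; first by apply: directed_union_connected FT _ => W; have [[]] := KF W.
exists (fd_subspace A), F; split=> //.
- by move=> W; have [[? ? ?] ? ?] := KF W; split.
- exact: directed_union_colimit.
- move=> W; exists W => x Wx; split; first exact: sub_gen_gsub.
  exact: fd_degree1 Wx.
Qed.

End FiniteDimensionalSystem.

(** * Application to Galois cohomology *)

Theorem theorem7p1 (p : nat) (K : fieldType) (L : sep_closure K)
    (A := galois_cohomology p L)
    (p_prime : prime p)
    (mu_p : forall z : L, z ^+ p = 1 -> exists y : K, z = sep_emb L y)
    (A_degree1 : generated_in_degree1 A)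
    (D : forall W : fd_subspace A, local_data W)
    (D_compat : forall W W' : fd_subspace A, W `<=` W' ->
       gen_gsub W `<=` gen_gsub W' /\
       exists j : ld_alg (D W) -> ld_alg (D W'), graded_hom j /\ injective j) :
  filtered_union_universally_Koszul A /\ asymptotically_universally_Koszul A.
Proof.
apply: fd_gen_asymptotically_universally_Koszul => // W.
exact: finite_type_universally_Koszul_iso (ld_phi_iso (D W))
  (ld_alg_Koszul (D W)).
Qed.
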